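(* Let $0<q<1$, $a>0$, and let $\mu(x;-a)=q^{-x}-aq^{x+1}$. For all nonnegative integers $n,n'$ the polynomials $\tilde D_n^{(a)}$ satisfy the two orthogonality relations $$\sum_{k=0}^\infty\frac{(1+aq^{4k+1})(-aq;q)_{2k}}{(1+aq)(q;q)_{2k}}\,q^{k(2k-1)}\tilde D_n^{(a)}(\mu(2k;-a)|q)\,\tilde D_{n'}^{(a)}(\mu(2k;-a)|q)=\frac{(-aq^3;q^2)_\infty}{(q;q^2)_\infty}\,\frac{(q^2;q^2)_n\,q^{-n}}{(-aq^2;q^2)_n}\,\delta_{nn'},$$ $$\sum_{k=0}^\infty\frac{(1+aq^{4k+3})(-aq;q)_{2k+1}}{(1+aq)(q;q)_{2k+1}}\,q^{k(2k+1)}\tilde D_n^{(a)}(\mu(2k+1;-a)|q)\,\tilde D_{n'}^{(a)}(\mu(2k+1;-a)|q)=\frac{(-aq^3;q^2)_\infty}{(q;q^2)_\infty}\,\frac{(q^2;q^2)_n\,q^{-n}}{(-aq^2;q^2)_n}\,\delta_{nn'} .$$ Moreover, both corresponding orthogonality measures (supported on $\{\mu(2k;-a)\}_{k\ge0}$ and on $\{\mu(2k+1;-a)\}_{k\ge0}$, respectively) are extremal.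
   Context: Notation: $(x;p)_k=\prod_{j=0}^{k-1}(1-xp^j)$, $(x;p)_\infty=\prod_{j\ge0}(1-xp^j)$, and ${}_3\phi_2(\alpha_1,\alpha_2,\alpha_3;\beta_1,\beta_2;q,z)=\sum_{k\ge0}\frac{(\alpha_1;q)_k(\alpha_2;q)_k(\alpha_3;q)_k}{(\beta_1;q)_k(\beta_2;q)_k(q;q)_k}z^k$; $\mathrm i=\sqrt{-1}$ and $\sqrt a>0$. Definition: $\tilde D_n^{(a)}(\mu(x;-a)|q)={}_3\phi_2(q^{-x},-aq^{x+1},q^{-n};\ \mathrm i\sqrt a\,q,-\mathrm i\sqrt a\,q;\ q,-q^{n+1})$, a real polynomial of degree $n$ in $\mu(x;-a)=q^{-x}-aq^{x+1}$ because $(q^{-x};q)_k(-aq^{x+1};q)_k=\prod_{j=0}^{k-1}(1-aq^{2j+1}-q^j\mu(x;-a))$. An orthogonality measure $\mu$ for a family of polynomials is called extremal if the family is complete in $L^2(\mu)$. *)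

(* Defs.v *)
From HB Require Import structures.
From mathcomp Require Import all_boot all_order all_algebra.
From mathcomp Require Import complex.
From mathcomp Require Import all_classical all_reals all_analysis.
From mathcomp Require Import ring lra.

Set Implicit Arguments.
Unset Strict Implicit.
Unset Printing Implicit Defensive.

Import Order.TTheory GRing.Theory Num.Theory.
Import numFieldNormedType.Exports.

Local Open Scope classical_set_scope.
Local Open Scope complex_scope.
Local Open Scope ring_scope.

Definition qpoch (K : fieldType) (x p : K) (k : nat) : K :=
  \prod_(j < k) (1 - x * p ^+ j).

Definition qpoch_inf (R : realType) (x p : R) : R :=
  limn (fun k => qpoch x p k).

Definition phi32_term (K : fieldType) (a1 a2 a3 b1 b2 q z : K) (k : nat) : K :=
  qpoch a1 q k * qpoch a2 q k * qpoch a3 q k /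
  (qpoch b1 q k * qpoch b2 q k * qpoch q q k) * z ^+ k.

Definition phi32 (K : numFieldType) (a1 a2 a3 b1 b2 q z : K) : K :=
  limn (series (phi32_term a1 a2 a3 b1 b2 q z) : nat -> K).

Lemma phi32_terminating (K : numFieldType) (a1 a2 a3 b1 b2 q z : K) (n : nat) :
  (forall k, (n < k)%N -> phi32_term a1 a2 a3 b1 b2 q z k = 0) ->
  phi32 a1 a2 a3 b1 b2 q z =
  \sum_(k < n.+1) phi32_term a1 a2 a3 b1 b2 q z k.
Proof.
move=> u0; apply: cvg_lim; first exact: norm_hausdorff.
apply: cvg_near_cst; exists n.+1 => // m /= nm.
apply/eqP; rewrite /series/= (big_cat_nat (leq0n n.+1) nm)/= big_mkord.
rewrite [X in _ + X](_ : _ = 0) ?addr0// big_nat_cond big1// => k.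
by move=> /andP[/andP[/u0]].
Qed.

Definition mu (R : realType) (q c x : R) : R := q `^ (- x) + c * q `^ (x + 1).

Definition Dtilde_value (R : realType) (q a : R) (n : nat) (x : R) : R[i] :=
  phi32 (q `^ (- x))%:C (- a * q `^ (x + 1))%:C (q ^- n)%:C
        ('i%C * (Num.sqrt a * q)%:C) (- 'i%C * (Num.sqrt a * q)%:C)
        q%:C (- q ^+ n.+1)%:C.

(* The values above are complex by construction, but they are those of a unique
   real polynomial in [mu q (- a) x]: see [DtildeP] and [DtildeE]. *)
Definition Dtilde (R : realType) (q a : R) (n : nat) : {poly R} :=
  xget 0 [set p : {poly R} |
    forall x : R, (p.[mu q (- a) x])%:C = Dtilde_value q a n x].

(* At [k = 0] the exponent is [0 * (2 * 0 - 1)], so truncated subtraction is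
   harmless. *)
Definition even_weight (R : realType) (q a : R) (k : nat) : R :=
  (1 + a * q ^+ (4 * k + 1)) * qpoch (- a * q) q (2 * k) /
  ((1 + a * q) * qpoch q q (2 * k)) * q ^+ (k * (2 * k - 1)).

Definition odd_weight (R : realType) (q a : R) (k : nat) : R :=
  (1 + a * q ^+ (4 * k + 3)) * qpoch (- a * q) q (2 * k + 1) /
  ((1 + a * q) * qpoch q q (2 * k + 1)) * q ^+ (k * (2 * k + 1)).

Definition Dtilde_norm2 (R : realType) (q a : R) (n : nat) : R :=
  qpoch_inf (- a * q ^+ 3) (q ^+ 2) / qpoch_inf q (q ^+ 2) *
  (qpoch (q ^+ 2) (q ^+ 2) n * q ^- n / qpoch (- a * q ^+ 2) (q ^+ 2) n).

Section Positivity.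
Context (R : realType) (q a : R) (hq : 0 < q < 1) (ha : 0 < a).

Let q_gt0 : 0 < q. Proof. by case/andP: hq. Qed.

Lemma qpoch_neg_gt0 (x p : R) k : 0 <= x -> 0 <= p -> 0 < qpoch (- x) p k.
Proof.
move=> x0 p0; apply: prodr_gt0 => j _.
by rewrite mulNr opprK ltr_pwDl // mulr_ge0 // exprn_ge0.
Qed.

Lemma qpoch_gt0 (x p : R) k : 0 <= x < 1 -> 0 <= p <= 1 -> 0 < qpoch x p k.
Proof.
move=> /andP[x0 x1] /andP[p0 p1]; apply: prodr_gt0 => j _.
rewrite subr_gt0 (le_lt_trans _ x1)// ler_piMr// exprn_ile1//.
Qed.

Lemma even_weight_gt0 k : 0 < even_weight q a k.
Proof.
case/andP: (hq) => q0 q1.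
rewrite /even_weight mulr_gt0 ?exprn_gt0// divr_gt0// mulr_gt0//.
- by rewrite ltr_pwDl// mulr_ge0 ?exprn_ge0// ltW.
- by rewrite mulNr qpoch_neg_gt0// ?mulr_ge0 ?ltW.
- by rewrite ltr_pwDl// mulr_ge0// ltW.
- by rewrite qpoch_gt0// ?q1 ?ltW.
Qed.

Lemma odd_weight_gt0 k : 0 < odd_weight q a k.
Proof.
case/andP: (hq) => q0 q1.
rewrite /odd_weight mulr_gt0 ?exprn_gt0// divr_gt0// mulr_gt0//.
- by rewrite ltr_pwDl// mulr_ge0 ?exprn_ge0// ltW.
- by rewrite mulNr qpoch_neg_gt0// ?mulr_ge0 ?ltW.
- by rewrite ltr_pwDl// mulr_ge0// ltW.
- by rewrite qpoch_gt0// ?q1 ?ltW.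
Qed.

Lemma even_weight_ge0 k : 0 <= even_weight q a k.
Proof. exact/ltW/even_weight_gt0. Qed.

Lemma odd_weight_ge0 k : 0 <= odd_weight q a k.
Proof. exact/ltW/odd_weight_gt0. Qed.

End Positivity.

Section DtildeTheory.
Context (R : realType) (q a : R) (hq : 0 < q < 1) (ha : 0 < a).

Let q_gt0 : 0 < q. Proof. by case/andP: hq. Qed.
Let q_lt1 : q < 1. Proof. by case/andP: hq. Qed.

Definition Dtilde_explicit (n : nat) : {poly R} :=
  \sum_(k < n.+1)
    (qpoch (q ^- n) q k / (qpoch (- a * q ^+ 2) (q ^+ 2) k * qpoch q q k) *
       (- q ^+ n.+1) ^+ k) *:
    \prod_(j < k) ((1 - a * q ^+ (2 * j + 1))%:P - q ^+ j *: 'X).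

Lemma qpochC (x p : R) k : qpoch x%:C p%:C k = (qpoch x p k)%:C.
Proof.
rewrite /qpoch rmorph_prod; apply: eq_bigr => j _.
by rewrite rmorphB rmorph1 rmorphM rmorphXn.
Qed.

Lemma qpoch_conjM k :
  qpoch ('i%C * (Num.sqrt a * q)%:C) q%:C k *
  qpoch (- 'i%C * (Num.sqrt a * q)%:C) q%:C k =
  (qpoch (- a * q ^+ 2) (q ^+ 2) k)%:C.
Proof.
rewrite /qpoch -big_split/= rmorph_prod; apply: eq_bigr => j _.
have e (x y z : R[i]) : (1 - x * y * z) * (1 - - x * y * z) =
    1 - x ^+ 2 * (y * z) ^+ 2 by ring.
rewrite e sqr_i -rmorphXn -rmorphM -rmorphXn/= mulN1r opprK.
rewrite mulNr mulNr opprK rmorphD rmorph1; congr (_ + _%:C).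
by rewrite !exprMn sqr_sqrtr ?ltW// -!exprM mulnC.
Qed.

Lemma Dtilde_prodE (x : R) k :
  \prod_(j < k) (1 - a * q ^+ (2 * j + 1) - q ^+ j * mu q (- a) x) =
  qpoch (q `^ (- x)) q k * qpoch (- a * q `^ (x + 1)) q k.
Proof.
rewrite /qpoch -big_split/=; apply: eq_bigr => j _.
have h : q `^ (- x) * q `^ (x + 1) = q.
  rewrite -powRD ?(gt_eqF q_gt0) ?implybT//.
  by rewrite addrA addNr add0r powRr1// ltW.
have -> : q ^+ (2 * j + 1) = q ^+ j * q ^+ j * (q `^ (- x) * q `^ (x + 1)).
  by rewrite h exprD expr1 mul2n -addnn exprD.
rewrite /mu; ring.
Qed.

Lemma Dtilde_explicit_value n (x : R) :
  ((Dtilde_explicit n).[mu q (- a) x])%:C = Dtilde_value q a n x.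
Proof.
rewrite /Dtilde_value; pose u := phi32_term (q `^ (- x))%:C
  (- a * q `^ (x + 1))%:C (q ^- n)%:C ('i%C * (Num.sqrt a * q)%:C)
  (- 'i%C * (Num.sqrt a * q)%:C) q%:C (- q ^+ n.+1)%:C.
have uE k : u k = (qpoch (q ^- n) q k /
    (qpoch (- a * q ^+ 2) (q ^+ 2) k * qpoch q q k) * (- q ^+ n.+1) ^+ k *
    \prod_(j < k) (1 - a * q ^+ (2 * j + 1) - q ^+ j * mu q (- a) x))%:C.
  rewrite /u /phi32_term qpoch_conjM !qpochC Dtilde_prodE.
  rewrite -!rmorphM -rmorphXn -fmorphV -!rmorphM/=; congr (_%:C); ring.
have u0 k : (n < k)%N -> u k = 0.
  move=> nk; rewrite uE /qpoch (bigD1 (Ordinal nk))//=.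
  by rewrite mulVf ?gt_eqF ?exprn_gt0// subrr !mul0r.
rewrite (phi32_terminating u0) -/u.
rewrite /Dtilde_explicit horner_sum rmorph_sum; apply: eq_bigr => k _.
rewrite uE hornerZ horner_prod; congr ((_ * _)%:C).
by apply: eq_bigr => j _; rewrite !hornerE.
Qed.

Lemma mu_lt (x y : R) : x < y -> mu q (- a) x < mu q (- a) y.
Proof.
move=> xy; rewrite /mu !mulNr.
have dec (s t : R) : s < t -> q `^ t < q `^ s.
  by move=> st; rewrite !/powR (gt_eqF q_gt0) ltr_expR ltr_nM2r ?ln_lt0 ?q_gt0.
rewrite ltrD ?dec ?ltrN2// ltr_pM2l// dec// ltrD2r//.
Qed.

Lemma poly_mu_inj (p1 p2 : {poly R}) :
  (forall x : R, p1.[mu q (- a) x] = p2.[mu q (- a) x]) -> p1 = p2.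
Proof.
move=> h; apply/eqP; rewrite -subr_eq0; apply/eqP.
pose s := [seq mu q (- a) k%:R | k <- iota 0 (size (p1 - p2))].
apply: (@roots_geq_poly_eq0 _ _ s).
- apply/allP => _ /mapP[k _ ->].
  by rewrite rootE hornerD hornerN h subrr.
- rewrite map_inj_uniq ?iota_uniq// => i j e.
  have [ij|ij|//] := ltngtP i j.
    by have := @mu_lt i%:R j%:R; rewrite ltr_nat e ltxx => /(_ ij).
  by have := @mu_lt j%:R i%:R; rewrite ltr_nat e ltxx => /(_ ij).
- by rewrite size_map size_iota.
Qed.

Lemma DtildeP n (x : R) :
  ((Dtilde q a n).[mu q (- a) x])%:C = Dtilde_value q a n x.
Proof.
have := @xgetPex _ 0 [set p : {poly R} |
  forall x : R, (p.[mu q (- a) x])%:C = Dtilde_value q a n x].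
by apply; exists (Dtilde_explicit n) => y; exact: Dtilde_explicit_value.
Qed.

Lemma DtildeE n : Dtilde q a n = Dtilde_explicit n.
Proof.
apply: poly_mu_inj => x.
by apply: complexI; rewrite DtildeP Dtilde_explicit_value.
Qed.

End DtildeTheory.

Definition discrete_measure (R : realType) (x w : nat -> R)
    (w_ge0 : forall k, 0 <= w k) : {measure set R -> \bar R} :=
  mseries (fun k => mscale (NngNum (w_ge0 k)) (dirac (x k))) 0.

Definition orthogonality_measure (R : realType)
    (m : {measure set R -> \bar R}) (P : nat -> {poly R}) : Prop :=
  [/\ forall n, (fun y => (P n).[y]) \in Lfun m 2%:E,
      forall n n', n != n' -> (\int[m]_y ((P n).[y] * (P n').[y])%:E = 0)%E &
      forall n, (0 < \int[m]_y ((P n).[y] ^+ 2)%:E)%E].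

(* Density of the linear span; since the polynomials are real, density in the
   real and in the complex L^2 space amount to the same. *)
Definition complete_in_L2 (R : realType)
    (m : {measure set R -> \bar R}) (P : nat -> {poly R}) : Prop :=
  forall f : R -> R, f \in Lfun m 2%:E ->
  forall e : R, 0 < e ->
  exists (N : nat) (c : 'I_N -> R),
    ('N[m]_2%:E[(fun y => (f y - \sum_(i < N) c i * (P i).[y])%:E)] < e%:E)%E.

Definition extremal (R : realType)
    (m : {measure set R -> \bar R}) (P : nat -> {poly R}) : Prop :=
  orthogonality_measure m P /\ complete_in_L2 m P.

(* Main.v *)
Require Import Defs.
From mathcomp Require Import all_boot all_order all_algebra.
From mathcomp Require Import all_classical all_reals all_analysis.
From mathcomp Require Import measurable_realfun.
From mathcomp Require Import ring lra zify.

(** The relations are dual to the orthogonality of another system. Write [D x n]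
    for the value of the polynomial of degree [n] at the lattice point [mu x],
    and regard it as a function of the degree [n].

    As functions of [n], the [D x] satisfy a recurrence in [x]
    ([Dval_recurrence]), which writes [q^n D x] as a combination of [D (x + 1)]
    and [D (x - 1)], and an eigenvalue equation for a second-order difference
    operator in [n], with eigenvalue [mu x] ([Dval_difference]). The operator is
    symmetric for the weight [v n = (- a q^2; q^2)_n q^n / (q^2; q^2)_n], and for
    even [x] the boundary terms vanish at infinity; hence [D x] is orthogonal to
    [D 0 = 1] for even [x > 0] ([sum_Dval_even]). The recurrence in [x] then
    yields the orthogonality of all [D x] with [x] of a given parity, together
    with their norms: the squared norm of [D x] is the total mass of [v] divided
    by the weight at [x] of the statement ([gram_dual]). The total mass is given
    by the q-binomial theorem ([dual_massE]).

    For each parity, the functions [D x] span the polynomials in [q^(2 n)],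
    multiplied by [q^n] when the parity is odd. Lagrange interpolation at the
    points [q^(2 n)], which converge geometrically, approximates every unit
    vector in [l2(v)], so each parity class is a complete orthogonal system
    ([parity_class_complete]). The infinite matrix of normalized values is
    therefore orthogonal on both sides ([dual_orthogonality]): its columns give
    the two stated relations, and the orthogonality of its rows amounts to
    Parseval's identity for the polynomials on the lattice, that is, to their
    completeness in the L2 space of each measure ([approx_l2],
    [extremal_discrete]). *)

Set Implicit Arguments.
Unset Strict Implicit.
Unset Printing Implicit Defensive.

Import Order.TTheory GRing.Theory Num.Theory.
Import numFieldNormedType.Exports.

Local Open Scope classical_set_scope.
Local Open Scope ring_scope.

(** * Sums of real series *)

(** The series with terms [f 0, f 1, ...] converges, with sum [l]. *)
Definition has_sum (R : realType) (f : nat -> R) (l : R) : Prop :=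
  series f @ \oo --> l.

Section HasSum.
Context (R : realType).
Implicit Types (f g v : nat -> R) (l m : R).

Lemma has_sum_ext f g l : f =1 g -> has_sum f l -> has_sum g l.
Proof. by move=> /funext ->. Qed.

Lemma has_sum_eq f l m : l = m -> has_sum f l -> has_sum f m.
Proof. by move=> ->. Qed.

Lemma has_sumD f g l m :
  has_sum f l -> has_sum g m -> has_sum (fun n => f n + g n) (l + m).
Proof. by move=> hf hg; rewrite /has_sum (seriesD f g); exact: cvgD. Qed.

Lemma has_sumZ (c : R) f l : has_sum f l -> has_sum (fun n => c * f n) (c * l).
Proof.
move=> hf; have := @seriesZ R (R : lmodType R) f c; rewrite /has_sum => ->.
exact: cvgMl_tmp.
Qed.
Arguments has_sumZ c {f l}.

Lemma has_sumB f g l m :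
  has_sum f l -> has_sum g m -> has_sum (fun n => f n - g n) (l - m).
Proof.
move=> hf hg; have := has_sumD hf (has_sumZ (-1) hg); rewrite mulN1r.
by apply: has_sum_ext => n; rewrite mulN1r.
Qed.

Lemma has_sum0 : has_sum (fun=> 0) (0 : R).
Proof.
rewrite /has_sum; have -> : series (fun=> 0) = (fun=> 0) :> (nat -> R).
  by apply/funext => n; rewrite /series/= big1.
exact: cvg_cst.
Qed.

Lemma has_sum_bigsum (M : nat) (F : nat -> nat -> R) (l : nat -> R) :
  (forall i, (i < M)%N -> has_sum (F i) (l i)) ->
  has_sum (fun n => \sum_(i < M) F i n) (\sum_(i < M) l i).
Proof.
elim: M => [_|M IH hF].
  rewrite big_ord0; apply: has_sum_ext has_sum0 => n; by rewrite big_ord0.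
rewrite big_ord_recr/=.
have h1 : has_sum (fun n => \sum_(i < M) F i n) (\sum_(i < M) l i).
  by apply: IH => i iM; apply: hF; rewrite ltnS ltnW.
apply: has_sum_ext (has_sumD h1 (hF M (ltnSn M))) => n.
by rewrite big_ord_recr.
Qed.

Lemma has_sum_finite f (M : nat) :
  (forall n, (M <= n)%N -> f n = 0) -> has_sum f (\sum_(n < M) f n).
Proof.
move=> f0; apply: cvg_near_cst; exists M => // m /= Mm.
rewrite /series/= (big_cat_nat (leq0n M) Mm)/= big_mkord.
rewrite [X in _ + X](_ : _ = 0) ?addr0// big_nat_cond big1// => k.
by move=> /andP[/andP[/f0]].
Qed.

Lemma has_sum_le f g l m :
  (forall n, f n <= g n) -> has_sum f l -> has_sum g m -> l <= m.
Proof.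
move=> fg hf hg; rewrite -(cvg_lim (@Rhausdorff R) hf) -(cvg_lim (@Rhausdorff R) hg).
by apply: lim_series_le => //; [exact: cvgP hf|exact: cvgP hg].
Qed.

Lemma has_sum_ge0 f l : (forall n, 0 <= f n) -> has_sum f l -> 0 <= l.
Proof. by move=> f0 hf; exact: has_sum_le f0 has_sum0 hf. Qed.

Lemma has_sum_ge_partial f l M :
  (forall n, 0 <= f n) -> has_sum f l -> \sum_(n < M) f n <= l.
Proof.
move=> f0 hf.
have h : has_sum (fun n => if (n < M)%N then f n else 0) (\sum_(n < M) f n).
  rewrite [X in has_sum _ X](_ : _ =
    \sum_(n < M) (if (n < M)%N then f n else 0)); last first.
    by apply: eq_bigr => i _; rewrite ltn_ord.
  apply: (@has_sum_finite (fun n => if (n < M)%N then f n else 0)) => n.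
  by rewrite leqNgt => /negbTE ->.
by apply: has_sum_le h hf => n; case: ifP.
Qed.

Lemma has_sum_uniq f l m : has_sum f l -> has_sum f m -> l = m.
Proof.
move=> hl hm; rewrite -(cvg_lim (@Rhausdorff R) hl).
exact: (cvg_lim (@Rhausdorff R) hm).
Qed.

Lemma has_sum_dominated f g m :
  (forall n, 0 <= f n <= g n) -> has_sum g m -> exists l, has_sum f l.
Proof.
move=> fg hg.
have h : cvgn (series f).
  apply: (@series_le_cvg R f g).
  - by move=> n; case/andP: (fg n).
  - by move=> n; case/andP: (fg n); exact: le_trans.
  - by move=> n; case/andP: (fg n).
  - exact: cvgP hg.
by exists (limn (series f)).
Qed.

Lemma has_sum_bounded v g (C m : R) : (forall n, 0 <= v n) ->
  (forall n, `|g n| <= C) -> has_sum v m ->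
  exists l, has_sum (fun n => v n * g n) l.
Proof.
move=> v0 gC hv.
have [l hl] : exists l, has_sum (fun n => v n * (g n + C)) l.
  apply: (@has_sum_dominated _ (fun n => 2 * C * v n)) (has_sumZ _ hv) => n.
  have := gC n; rewrite ler_norml => /andP[g1 g2].
  rewrite mulr_ge0//=; last lra.
  rewrite mulrC ler_wpM2r//; lra.
exists (l - C * m); apply: has_sum_ext (has_sumB hl (has_sumZ C hv)) => n.
ring.
Qed.

Lemma has_sum_tail f l (e : R) : has_sum f l -> 0 < e ->
  exists M, forall M', (M <= M')%N -> `|l - \sum_(n < M') f n| < e.
Proof.
move=> hf e0; have /cvgrPdist_lt/(_ e e0)[M _ hM] := hf.
by exists M => M' /hM; rewrite /series/= big_mkord.
Qed.

Lemma has_sum_term f l : has_sum f l -> f @ \oo --> 0.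
Proof. by move=> hf; apply: cvg_series_cvg_0; exact: cvgP hf. Qed.

Lemma has_sum_shift f l :
  has_sum f l -> has_sum (fun n => f n.+1) (l - f 0%N).
Proof.
move=> hf; have h : [sequence series f n.+1]_n @ \oo --> l by rewrite cvg_shiftS.
rewrite /has_sum; have -> : series (fun n => f n.+1) =
    (fun n => series f n.+1 - f 0%N).
  apply/funext => n; rewrite /series/= [in RHS]big_nat_recl//= addrC addKr.
  by [].
by apply: cvgB => //; exact: cvg_cst.
Qed.

(** The ratio test. *)
Lemma has_sum_ratio v (r : R) n0 : (forall n, 0 <= v n) -> 0 <= r < 1 ->
  (forall n, (n0 <= n)%N -> v n.+1 <= r * v n) -> exists l, has_sum v l.
Proof.
move=> v0 /andP[r0 r1] hr.
have vg n : v (n + n0)%N <= v n0 * r ^+ n.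
  elim: n => [|n IH]; first by rewrite expr0 mulr1.
  rewrite addSn; apply: le_trans (hr _ (leq_addl n n0)) _.
  by rewrite exprS mulrCA ler_wpM2l.
have hg : has_sum (fun n => v n0 * r ^+ n) (v n0 / (1 - r)).
  by apply: cvg_geometric_series; rewrite ger0_norm.
have [l hl] : exists l, has_sum (fun n => v (n + n0)%N) l.
  apply: has_sum_dominated hg => n; by rewrite v0 vg.
exists (l + \sum_(k < n0) v k).
rewrite /has_sum -(cvg_shiftn n0).
have -> : [sequence series v (n + n0)%N]_n =
    (fun n => series (fun n => v (n + n0)%N) n + \sum_(k < n0) v k).
  apply/funext => n /=; rewrite /series/= (big_cat_nat (leq0n n0) (leq_addl n n0))/=.
  rewrite big_mkord addrC; congr (_ + _).
  by rewrite -{1}(add0n n0) big_addn addnK.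
by apply: cvgD => //; exact: cvg_cst.
Qed.

End HasSum.
Arguments has_sumZ {R} c {f l}.

(** * Dual orthogonality in weighted l2 spaces *)

(** The sequences [phi i] are orthogonal for the positive weight [w], with
    squared norms [H i]. *)
Section Expansion.
Context (R : realType) (w : nat -> R) (phi : nat -> nat -> R) (H : nat -> R).
Hypothesis w_gt0 : forall k, 0 < w k.
Hypothesis H_gt0 : forall i, 0 < H i.
Hypothesis orth : forall i j,
  has_sum (fun k => w k * (phi i k * phi j k)) (H i * (i == j)%:R).

(* [b d K i] is the inner product of [d], supported below [K], with [phi i]. *)
Let b (d : nat -> R) K i := \sum_(k < K) w k * d k * phi i k.

Lemma expansion (d c : nat -> R) K N : (forall k, (K <= k)%N -> d k = 0) ->
  has_sum (fun k => w k * (d k - \sum_(i < N) c i * phi i k) ^+ 2)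
    (\sum_(k < K) w k * d k ^+ 2 - 2 * (\sum_(i < N) c i * b d K i) +
     \sum_(i < N) c i ^+ 2 * H i).
Proof.
move=> d0.
have h1 : has_sum (fun k => w k * d k ^+ 2) (\sum_(k < K) w k * d k ^+ 2).
  by apply: has_sum_finite => k /d0 ->; rewrite expr0n/= mulr0.
have h2 : has_sum (fun k => \sum_(i < N) c i * (w k * d k * phi i k))
    (\sum_(i < N) c i * b d K i).
  apply: (@has_sum_bigsum _ _ (fun i k => c i * (w k * d k * phi i k))
           (fun i => c i * b d K i)) => i _.
  apply: has_sumZ; apply: (has_sum_finite (f := fun k => w k * d k * phi i k)).
  by move=> k /d0 ->; rewrite mulr0 mul0r.
have h3 : has_sum (fun k => \sum_(i < N) \sum_(j < N)
      c i * c j * (w k * (phi i k * phi j k)))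
    (\sum_(i < N) c i ^+ 2 * H i).
  have := @has_sum_bigsum R N (fun i k => \sum_(j < N)
      c i * c j * (w k * (phi i k * phi j k))) (fun i => c i ^+ 2 * H i).
  apply => i iN.
  have -> : c i ^+ 2 * H i = \sum_(j < N) c i * c j * (H i * (i == j)%:R).
    rewrite (bigD1 (Ordinal iN))//= eqxx mulr1 big1 ?addr0 ?expr2// => j.
    by rewrite -val_eqE/= eq_sym => /negbTE ->; rewrite !mulr0.
  apply: (@has_sum_bigsum R N (fun j k => c i * c j * (w k * (phi i k * phi j k)))
    (fun j => c i * c j * (H i * (i == j)%:R))) => j _.
  exact: has_sumZ.
apply: has_sum_ext (has_sumD (has_sumB h1 (has_sumZ 2 h2)) h3) => k.
set S := \sum_(i < N) c i * phi i k.
have -> : \sum_(i < N) c i * (w k * d k * phi i k) = w k * d k * S.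
  by rewrite mulr_sumr; apply: eq_bigr => i _; ring.
have -> : \sum_(i < N) \sum_(j < N) c i * c j * (w k * (phi i k * phi j k)) =
    w k * S ^+ 2.
  rewrite expr2 {1}/S big_distrl/= mulr_sumr; apply: eq_bigr => i _.
  by rewrite mulr_sumr mulr_sumr; apply: eq_bigr => j _; ring.
ring.
Qed.

Arguments expansion {d} c {K} N _.

(** The squared distance of [d] to its orthogonal projection on the first [N] of
    the [phi i], whose coefficients are [b d K i / H i]. *)
Lemma best_approximation (d : nat -> R) K N :
  (forall k, (K <= k)%N -> d k = 0) ->
  has_sum (fun k => w k * (d k - \sum_(i < N) b d K i / H i * phi i k) ^+ 2)
    (\sum_(k < K) w k * d k ^+ 2 - \sum_(i < N) b d K i ^+ 2 / H i).
Proof.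
move=> d0; apply: has_sum_eq (expansion (fun i => b d K i / H i) N d0).
rewrite -addrA; congr (_ + _).
have -> : \sum_(i < N) b d K i / H i * b d K i = \sum_(i < N) b d K i ^+ 2 / H i.
  by apply: eq_bigr => i _; ring.
have -> : \sum_(i < N) (b d K i / H i) ^+ 2 * H i =
    \sum_(i < N) b d K i ^+ 2 / H i.
  apply: eq_bigr => i _; rewrite exprMn -mulrA; congr (_ * _).
  by rewrite expr2 -mulrA mulVf ?mulr1// gt_eqF.
ring.
Qed.

Arguments best_approximation {d K} N _.

Lemma bessel (d : nat -> R) K N : (forall k, (K <= k)%N -> d k = 0) ->
  \sum_(i < N) b d K i ^+ 2 / H i <= \sum_(k < K) w k * d k ^+ 2.
Proof.
move=> d0; rewrite -subr_ge0; apply: has_sum_ge0 (best_approximation N d0) => k.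
by rewrite mulr_ge0 ?sqr_ge0// ltW.
Qed.

Lemma best_approximation_le (d c : nat -> R) K N l :
  (forall k, (K <= k)%N -> d k = 0) ->
  has_sum (fun k => w k * (d k - \sum_(i < N) c i * phi i k) ^+ 2) l ->
  \sum_(k < K) w k * d k ^+ 2 - \sum_(i < N) b d K i ^+ 2 / H i <= l.
Proof.
move=> d0 hl; rewrite (has_sum_uniq hl (expansion c N d0)) -addrA lerD2l.
rewrite -subr_ge0 opprK mulr_sumr -sumrN -!big_split/=.
apply: sumr_ge0 => i _; have Hi := H_gt0 i.
have -> : - (2 * (c i * b d K i)) + c i ^+ 2 * H i + b d K i ^+ 2 / H i =
    H i * (c i - b d K i / H i) ^+ 2 by field; rewrite gt_eqF.
by rewrite mulr_ge0 ?sqr_ge0// ltW.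
Qed.

Let delta (N k : nat) : R := (k == N)%:R.

Let delta0 N k : (N.+1 <= k)%N -> delta N k = 0.
Proof. by move=> Nk; rewrite /delta gtn_eqF. Qed.

Let b_delta N K i (s : R) : (N < K)%N ->
  b (fun k => s * delta N k) K i = w N * s * phi i N.
Proof.
move=> NK; rewrite /b (bigD1 (Ordinal NK))//= /delta eqxx mulr1 big1 ?addr0// => k.
by rewrite -val_eqE/= => /negbTE ->; rewrite !mulr0 mul0r.
Qed.

(* Each unit vector is a limit of linear combinations of the [phi i]. *)
Hypothesis complete : forall N (e : R), 0 < e -> exists (M : nat) (c : nat -> R) l,
  has_sum (fun k => w k * ((k == N)%:R - \sum_(i < M) c i * phi i k) ^+ 2) l /\ l < e.

(* The partial sums of the dual inner product. *)
Let S N N' M := \sum_(i < M) phi i N * phi i N' / H i.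

(** Bessel's inequality for the vector equal to [1 / w N] at [N] and to
    [s / w N'] at [N']. *)
Lemma dual_bessel N N' (s : R) M : N != N' ->
  S N N M + 2 * s * S N N' M + s ^+ 2 * S N' N' M <=
  (w N)^-1 + s ^+ 2 * (w N')^-1.
Proof.
move=> NN'; pose K := (maxn N N').+1.
have NK : (N < K)%N by rewrite ltnS leq_maxl.
have NK' : (N' < K)%N by rewrite ltnS leq_maxr.
pose d k := (w N)^-1 * delta N k + s * (w N')^-1 * delta N' k.
have d0 k : (K <= k)%N -> d k = 0.
  move=> Kk; rewrite /d !delta0 ?mulr0 ?addr0//.
    exact: leq_trans NK' Kk.
  exact: leq_trans NK Kk.
have wN := w_gt0 N; have wN' := w_gt0 N'.
have bE i : b d K i = phi i N + s * phi i N'.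
  have -> : b d K i = b (fun k => (w N)^-1 * delta N k) K i +
      b (fun k => s * (w N')^-1 * delta N' k) K i.
    by rewrite /b -big_split; apply: eq_bigr => k _ /=; rewrite /d; ring.
  by rewrite !b_delta//; field; rewrite !gt_eqF.
have := bessel M d0.
have -> : \sum_(i < M) b d K i ^+ 2 / H i =
    S N N M + 2 * s * S N N' M + s ^+ 2 * S N' N' M.
  rewrite /S !mulr_sumr -!big_split/=; apply: eq_bigr => i _; rewrite bE; ring.
have -> : \sum_(k < K) w k * d k ^+ 2 = (w N)^-1 + s ^+ 2 * (w N')^-1.
  rewrite (bigD1 (Ordinal NK))//= (bigD1 (Ordinal NK'))/=; last first.
    by rewrite -val_eqE/= eq_sym.
  rewrite big1 => [|k /andP[]]; last first.
    rewrite -!val_eqE/= => /negbTE kN /negbTE kN'.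
    by rewrite /d /delta kN kN' !mulr0 addr0 expr0n/= mulr0.
  rewrite /d /delta !eqxx (negbTE NN') eq_sym (negbTE NN') !mulr0 !mulr1 addr0 add0r.
  by field; rewrite !gt_eqF.
by [].
Qed.

(** Parseval's identity for a unit vector. *)
Lemma dual_norm N : has_sum (fun i => phi i N * phi i N / H i) (w N)^-1.
Proof.
have wN := w_gt0 N.
pose d k := 1 * delta N k.
have d0 k : (N.+1 <= k)%N -> d k = 0 by move=> /delta0; rewrite /d mul1r.
have bE i : b d N.+1 i = w N * phi i N by rewrite b_delta// mulr1.
have SE M : \sum_(i < M) b d N.+1 i ^+ 2 / H i = w N ^+ 2 * S N N M.
  by rewrite /S mulr_sumr; apply: eq_bigr => i _; rewrite bE; ring.
have dE : \sum_(k < N.+1) w k * d k ^+ 2 = w N.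
  rewrite big_ord_recr/= big1 => [|k _]; last first.
    by rewrite /d /delta ltn_eqF// mulr0 expr0n/= mulr0.
  by rewrite /d /delta eqxx add0r mulr1 expr1n mulr1.
have SN M : series (fun i => phi i N * phi i N / H i) M = S N N M.
  by rewrite /series/= big_mkord.
have Smono M M' : (M <= M')%N -> S N N M <= S N N M'.
  move=> MM'; rewrite -!SN; apply: nondecreasing_series => // i _ _.
  by rewrite divr_ge0 ?(ltW (H_gt0 _))// -expr2 sqr_ge0.
apply/cvgrPdist_lt => e e0.
have [|M [c [l [hl le]]]] := complete N (e := w N ^+ 2 * e).
  by rewrite mulr_gt0 ?exprn_gt0.
exists M => // m /= /Smono; rewrite SN => MS.
have := bessel m d0; rewrite SE dE => B1.
have hl' : has_sum (fun k => w k * (d k - \sum_(i < M) c i * phi i k) ^+ 2) l.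
  by apply: has_sum_ext hl => k; rewrite /d mul1r.
have := best_approximation_le d0 hl'; rewrite SE dE => B2.
have wV : w N = w N ^+ 2 * (w N)^-1 by field; rewrite gt_eqF.
have h1 : S N N m <= (w N)^-1.
  by rewrite -(ler_pM2l (exprn_gt0 2 wN)) -wV.
have h2 : (w N)^-1 - S N N M < e.
  rewrite -(ltr_pM2l (exprn_gt0 2 wN)) mulrBr -wV; lra.
rewrite ger0_norm; lra.
Qed.

Arguments dual_norm : clear implicits.

(** If an orthogonal system is complete, the transposed system is orthogonal
    with respect to the weights [1 / H i]. *)
Lemma dual_orthogonality N N' :
  has_sum (fun i => phi i N * phi i N' / H i) ((N == N')%:R / w N).
Proof.
have [<-|NN'] := eqVneq N N'; first by rewrite div1r; exact: dual_norm.
rewrite mul0r; have hN := dual_norm N; have hN' := dual_norm N'.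
have SN P Q M : series (fun i => phi i P * phi i Q / H i) M = S P Q M.
  by rewrite /series/= big_mkord.
apply/cvgrPdist_lt => e e0.
have /cvgrPdist_lt/(_ e e0)[M _ hM] := hN.
have /cvgrPdist_lt/(_ e e0)[M' _ hM'] := hN'.
exists (maxn M M') => // m /=; rewrite geq_max => /andP[/hM + /hM'].
rewrite /= !SN sub0r normrN => /ltr_normlW A /ltr_normlW B.
(* Bessel's inequality for the signs [1] and [-1] bounds the off-diagonal
   partial sum by the defects of the two diagonal ones. *)
have := dual_bessel 1 m NN'; have := dual_bessel (-1) m NN'.
by rewrite ltr_norml => C D; apply/andP; split; lra.
Qed.

End Expansion.
Arguments expansion {R w phi H} _ {d} c {K} N _.
Arguments best_approximation {R w phi H} _ _ {d K} N _.

(** Conversely, orthogonality of the transposed system gives completeness. *)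
Section Approximation.
Context (R : realType) (w : nat -> R) (phi : nat -> nat -> R) (H : nat -> R).
Hypothesis w_gt0 : forall k, 0 < w k.
Hypothesis H_gt0 : forall i, 0 < H i.
Hypothesis orth : forall i j,
  has_sum (fun k => w k * (phi i k * phi j k)) (H i * (i == j)%:R).
Hypothesis dual : forall N N',
  has_sum (fun i => phi i N * phi i N' / H i) ((N == N')%:R / w N).

Lemma approx_finite (d : nat -> R) K (e : R) :
  (forall k, (K <= k)%N -> d k = 0) -> 0 < e ->
  exists (N : nat) (c : nat -> R) l,
    has_sum (fun k => w k * (d k - \sum_(i < N) c i * phi i k) ^+ 2) l /\ l < e.
Proof.
move=> d0 e0; pose b i := \sum_(k < K) w k * d k * phi i k.
have hb : has_sum (fun i => b i ^+ 2 / H i) (\sum_(k < K) w k * d k ^+ 2).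
  have h : has_sum (fun i => \sum_(k < K) \sum_(l < K)
      w k * d k * (w l * d l) * (phi i k * phi i l / H i))
      (\sum_(k < K) w k * d k ^+ 2).
    apply: (@has_sum_bigsum R K (fun k i => \sum_(l < K)
      w k * d k * (w l * d l) * (phi i k * phi i l / H i))
      (fun k => w k * d k ^+ 2)) => k kK.
    have -> : w k * d k ^+ 2 =
        \sum_(l < K) w k * d k * (w l * d l) * ((k == l)%:R / w k).
      rewrite (bigD1 (Ordinal kK))//= eqxx/= big1 ?addr0.
        by field; rewrite gt_eqF.
      move=> l; rewrite -val_eqE/= eq_sym => /negbTE ->.
      by rewrite mul0r mulr0.
    apply: (@has_sum_bigsum R K (fun l i =>
      w k * d k * (w l * d l) * (phi i k * phi i l / H i))
      (fun l => w k * d k * (w l * d l) * ((k == l)%:R / w k))) => l _.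
    exact: has_sumZ.
  apply: has_sum_ext h => i.
  rewrite expr2 /b big_distrl/= mulr_suml; apply: eq_bigr => k _.
  rewrite mulr_sumr mulr_suml; apply: eq_bigr => l _; ring.
have [N /(_ N (leqnn N)) hN] := has_sum_tail hb e0.
have hl := best_approximation H_gt0 orth N d0.
exists N, (fun i => b i / H i); eexists; split; first exact: hl.
exact: le_lt_trans (ler_norm _) hN.
Qed.

Lemma approx_l2 (f : nat -> R) (s e : R) :
  has_sum (fun k => w k * f k ^+ 2) s -> 0 < e ->
  exists (N : nat) (c : nat -> R) l,
    has_sum (fun k => w k * (f k - \sum_(i < N) c i * phi i k) ^+ 2) l /\ l < e.
Proof.
move=> hf e0.
have [K /(_ K (leqnn K)) hK] := has_sum_tail hf (divr_gt0 e0 (ltr0n R 4)).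
(* [d] carries all but a quarter of [e] of the squared norm of [f]. *)
pose d k := if (k < K)%N then f k else 0.
have d0 k : (K <= k)%N -> d k = 0 by rewrite /d leqNgt => /negbTE ->.
have [N [c [l [hl le]]]] := approx_finite d0 (divr_gt0 e0 (ltr0n R 4)).
have ht : has_sum (fun k => w k * (f k - d k) ^+ 2)
    (s - \sum_(k < K) w k * f k ^+ 2).
  have h : has_sum (fun k => w k * d k ^+ 2) (\sum_(k < K) w k * f k ^+ 2).
    have -> : \sum_(k < K) w k * f k ^+ 2 = \sum_(k < K) w k * d k ^+ 2.
      by apply: eq_bigr => k _; rewrite /d ltn_ord.
    by apply: has_sum_finite => k /d0 ->; rewrite expr0n/= mulr0.
  apply: has_sum_ext (has_sumB hf h) => k.
  by rewrite /d; case: ifP => _; ring.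
have hS := has_sumD (has_sumZ 2 hl) (has_sumZ 2 ht).
have dom k : 0 <= w k * (f k - \sum_(i < N) c i * phi i k) ^+ 2 <=
    2 * (w k * (d k - \sum_(i < N) c i * phi i k) ^+ 2) +
    2 * (w k * (f k - d k) ^+ 2).
  set S := \sum_(i < N) _; have wk := w_gt0 k.
  rewrite mulr_ge0 ?sqr_ge0 ?(ltW wk)//= -subr_ge0.
  have -> : 2 * (w k * (d k - S) ^+ 2) + 2 * (w k * (f k - d k) ^+ 2) -
      w k * (f k - S) ^+ 2 = w k * (d k - S - (f k - d k)) ^+ 2 by ring.
  by rewrite mulr_ge0 ?sqr_ge0 ?(ltW wk).
have [m hm] := has_sum_dominated dom hS.
exists N, c, m; split => //.
have := has_sum_le (fun k => proj2 (andP (dom k))) hm hS.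
move/ltr_normlW: hK => hK; lra.
Qed.

End Approximation.

(** * The two recurrences satisfied by the polynomials *)

(** Throughout, [X] stands for [q ^+ x] and [y] for [q ^+ n]. *)
Section Recurrences.
Context (R : realType) (q a : R) (hq : 0 < q < 1) (ha : 0 < a).

Let q_gt0 : 0 < q. Proof. by case/andP: hq. Qed.
Let q_lt1 : q < 1. Proof. by case/andP: hq. Qed.
Let q_neq0 : q != 0. Proof. by rewrite gt_eqF. Qed.

Let qn_gt0 n : 0 < q ^+ n. Proof. exact: exprn_gt0. Qed.
Let qn_neq0 n : q ^+ n != 0. Proof. by rewrite gt_eqF. Qed.
Let qS_lt1 n : q ^+ n.+1 < 1.
Proof. by rewrite exprn_ilt1// ltW. Qed.
Let qn_le1 n : q ^+ n <= 1.
Proof. by rewrite exprn_ile1// ltW. Qed.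

Let expq1 k : q ^+ (2 * k + 1) = q * (q ^+ k) ^+ 2.
Proof. by rewrite exprD expr1 mulnC exprM mulrC. Qed.
Let expq2 k : q ^+ (2 * k + 2) = q ^+ 2 * (q ^+ k) ^+ 2.
Proof. by rewrite exprD mulnC exprM mulrC. Qed.

Lemma one_plus_gt0 (z : R) : 0 <= z -> 0 < 1 + a * z.
Proof. by move=> z0; rewrite ltr_pwDl// mulr_ge0// ltW. Qed.

(** The product of [(q^(-x); q)_k] and [(- a q^(x + 1); q)_k], as a function of
    [X = q ^+ x]. *)
Definition xbasis (X : R) k : R :=
  \prod_(j < k) ((1 - q ^+ j / X) * (1 + a * q ^+ j.+1 * X)).

(** The coefficient of [xbasis X k] in the value of degree [n] at [x], as a
    function of [y = q ^+ n]; it vanishes for [n < k]. *)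
Definition ycoef (y : R) k : R :=
  \prod_(j < k) (q * (q ^+ j - y) /
                 ((1 + a * q ^+ (2 * j + 2)) * (1 - q ^+ j.+1))).

Lemma xbasisS X k : xbasis X k.+1 =
  xbasis X k * ((1 - q ^+ k / X) * (1 + a * q ^+ k.+1 * X)).
Proof. by rewrite /xbasis big_ord_recr. Qed.

Lemma ycoefS y k : ycoef y k.+1 =
  ycoef y k * (q * (q ^+ k - y) /
                 ((1 + a * q ^+ (2 * k + 2)) * (1 - q ^+ k.+1))).
Proof. by rewrite /ycoef big_ord_recr. Qed.

Lemma xbasis0 X : xbasis X 0 = 1. Proof. by rewrite /xbasis big_ord0. Qed.
Lemma ycoef0 y : ycoef y 0 = 1. Proof. by rewrite /ycoef big_ord0. Qed.

Lemma ycoef_eq0 n k : (n < k)%N -> ycoef (q ^+ n) k = 0.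
Proof.
move=> nk; rewrite /ycoef (bigD1 (Ordinal nk))//= subrr.
by rewrite !(mulr0, mul0r).
Qed.

(** The value of the polynomial of degree [n] at the lattice point [mu x]. *)
Definition Dval (x n : nat) : R := (Dtilde q a n).[mu q (- a) x%:R].

Lemma mu_nat (x : nat) : mu q (- a) x%:R = (q ^+ x)^-1 - a * q * q ^+ x.
Proof.
rewrite /mu powRN natr1 !powR_mulrn ?ltW// exprS; ring.
Qed.

(** The sum may be truncated at any bound beyond [n]. *)
Lemma Dval_expansion K x n : (n < K)%N ->
  Dval x n = \sum_(k < K) ycoef (q ^+ n) k * xbasis (q ^+ x) k.
Proof.
move=> nK; rewrite -(subnKC nK) big_split_ord/= [X in _ + X]big1 ?addr0; last first.
  by move=> i _; rewrite ycoef_eq0 ?mul0r// leq_addr.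
rewrite /Dval DtildeE// /Dtilde_explicit horner_sum; apply: eq_bigr => k _.
rewrite hornerZ horner_prod.
rewrite /qpoch /ycoef /xbasis.
have -> : (- q ^+ n.+1) ^+ k = \prod_(j < k) (- q ^+ n.+1).
  by rewrite prodr_const card_ord.
rewrite -!big_split/= -prodfV -!big_split/=.
apply: eq_bigr => j _.
rewrite !hornerE mu_nat/= [q ^+ 2 ^+ j]exprAC expq2 expq1.
rewrite [q ^+ n.+1]exprS [q ^+ j.+1]exprS.
have D2 : 1 - q * q ^+ j != 0 by rewrite -exprS gt_eqF// subr_gt0.
by field; rewrite !qn_neq0 D2 gt_eqF// one_plus_gt0 ?sqr_ge0.
Qed.

(** The coefficients of the recurrence [Dval_recurrence] in [x]. *)
Definition rec_up x : R := q ^+ x * (1 + a * q ^+ x.+1) / (1 + a * q ^+ (2 * x + 1)).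
Definition rec_down x : R := (1 - q ^+ x) / (1 + a * q ^+ (2 * x + 1)).

Lemma rec_down0 : rec_down 0 = 0. Proof. by rewrite /rec_down subrr mul0r. Qed.

Lemma rec_up_gt0 x : 0 < rec_up x.
Proof. by rewrite divr_gt0 ?mulr_gt0 ?one_plus_gt0 ?exprn_ge0 ?ltW. Qed.

Lemma rec_downS_gt0 x : 0 < rec_down x.+1.
Proof. by rewrite divr_gt0 ?subr_gt0 ?one_plus_gt0 ?exprn_ge0 ?ltW. Qed.

Lemma xbasis_shift_up X k : X != 0 ->
  (1 + a * q * X) * xbasis (q * X) k.+1 =
  (1 - (q * X)^-1) * (1 + a * q ^+ k.+1 * X) * (1 + a * q ^+ k.+2 * X) * xbasis X k.
Proof.
move=> X0; elim: k => [|k IH].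
  by rewrite xbasisS !xbasis0 expr0 expr1 expr2; field; rewrite X0.
rewrite xbasisS mulrA IH xbasisS [q ^+ k.+3]exprS [q ^+ k.+2]exprS [q ^+ k.+1]exprS.
by field; rewrite X0.
Qed.

Lemma xbasis_shift_down X k : X != 0 ->
  (1 - X) * xbasis (X / q) k.+1 =
  - X * (1 + a * X) * (1 - q ^+ k / X) * (1 - q ^+ k.+1 / X) * xbasis X k.
Proof.
move=> X0; elim: k => [|k IH].
  by rewrite xbasisS !xbasis0 expr0 expr1; field; rewrite X0.
rewrite xbasisS mulrA IH xbasisS [q ^+ k.+2]exprS [q ^+ k.+1]exprS.
by field; rewrite X0.
Qed.

Lemma xbasis_recurrence x k :
  rec_up x * xbasis (q ^+ x.+1) k.+1 + rec_down x * xbasis (q ^+ x / q) k.+1 =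
  q ^+ k.+1 * xbasis (q ^+ x) k.+1 -
  (1 + a * q ^+ (2 * k + 2)) * (1 - q ^+ k.+1) / q * xbasis (q ^+ x) k.
Proof.
have h1 := xbasis_shift_up k (qn_neq0 x).
have h2 := xbasis_shift_down k (qn_neq0 x).
rewrite /rec_up /rec_down [q ^+ x.+1]exprS expq1 expq2.
have D : 1 + a * (q * (q ^+ x) ^+ 2) != 0.
  by rewrite gt_eqF// one_plus_gt0// mulr_ge0 ?sqr_ge0 ?ltW.
have -> : q ^+ x * (1 + a * (q * q ^+ x)) / (1 + a * (q * q ^+ x ^+ 2)) *
    xbasis (q * q ^+ x) k.+1 =
    q ^+ x / (1 + a * (q * q ^+ x ^+ 2)) *
    ((1 + a * q * q ^+ x) * xbasis (q * q ^+ x) k.+1) by field.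
rewrite h1 [(1 - q ^+ x) / _ * _]mulrAC h2 xbasisS [q ^+ k.+2]exprS [q ^+ k.+1]exprS.
by field; rewrite qn_neq0 D q_neq0.
Qed.

Lemma rec_up_down x : rec_up x + rec_down x = 1.
Proof.
rewrite /rec_up /rec_down exprS expq1.
have D : 1 + a * (q * (q ^+ x) ^+ 2) != 0.
  by rewrite gt_eqF// one_plus_gt0// mulr_ge0 ?sqr_ge0 ?ltW.
by field.
Qed.

Let den_neq0 k : (1 + a * q ^+ (2 * k + 2)) * (1 - q ^+ k.+1) != 0.
Proof.
by rewrite mulf_neq0// gt_eqF ?subr_gt0// one_plus_gt0// ltW.
Qed.

Lemma sum_recurrence x y K :
  \sum_(k < K.+1) ycoef y k *
    (rec_up x * xbasis (q ^+ x.+1) k + rec_down x * xbasis (q ^+ x / q) k) =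
  y * (\sum_(k < K) ycoef y k * xbasis (q ^+ x) k) +
  q ^+ K * ycoef y K * xbasis (q ^+ x) K.
Proof.
elim: K => [|K IH].
  rewrite big_ord_recl !big_ord0 !xbasis0 !ycoef0 !mulr1 rec_up_down; ring.
rewrite big_ord_recr/= IH xbasis_recurrence big_ord_recr/= ycoefS.
have := den_neq0 K; set d := (_ * (1 - _)) => d0.
by field; rewrite q_neq0 d0.
Qed.

(** As a function of [n], multiplication by [q ^+ n] raises and lowers [x]
    by one. At [x = 0] the lowering coefficient vanishes, so that the truncated
    predecessor is harmless. *)
Lemma Dval_recurrence x n :
  q ^+ n * Dval x n = rec_up x * Dval x.+1 n + rec_down x * Dval x.-1 n.
Proof.
have [nK nK'] : (n < n.+1)%N /\ (n < n.+2)%N by rewrite !ltnS leqnSn.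
have := sum_recurrence x (q ^+ n) n.+1.
rewrite -(Dval_expansion x nK) ycoef_eq0// mulr0 mul0r addr0 => <-.
rewrite (Dval_expansion x.+1 nK') (Dval_expansion x.-1 nK') !mulr_sumr -big_split/=.
apply: eq_bigr => k _; rewrite mulrDr; congr (_ + _); first by ring.
case: x => [|x]; first by rewrite rec_down0; ring.
by rewrite /= exprS mulrC mulrA -[q * _ / q]mulrAC divff// mul1r; ring.
Qed.

(** The lattice [mu(x; -a)] at the natural number [x]; see [mu_nat]. *)
Definition lattice x : R := (q ^+ x)^-1 - a * q * q ^+ x.

Lemma lattice_neq x : lattice x.+1 - lattice 0 != 0.
Proof.
rewrite gt_eqF// /lattice expr0 invr1 mulr1.
have h1 : 1 < (q ^+ x.+1)^-1 by rewrite invf_gt1.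
have h2 : a * q * q ^+ x.+1 < a * q.
  by rewrite gtr_pMr ?mulr_gt0.
lra.
Qed.

Lemma xbasis_mul_lattice x k : lattice x * xbasis (q ^+ x) k =
  (q ^+ k)^-1 * ((1 - a * q ^+ (2 * k + 1)) * xbasis (q ^+ x) k -
                 xbasis (q ^+ x) k.+1).
Proof.
rewrite xbasisS /lattice exprS expq1; field.
by rewrite !qn_neq0.
Qed.

(** The coefficients of the difference equation [Dval_difference] in [n]. *)
Definition diff_up (y : R) : R := - (1 + a * q ^+ 2 * y ^+ 2) / (q * y ^+ 2).
Definition diff_down (y : R) : R := - (1 - y ^+ 2) / y ^+ 2.

Lemma ycoef_shift_up y k : ycoef (q * y) k.+1 =
  q ^+ k * (1 - q * y) * q / ((1 + a * q ^+ (2 * k + 2)) * (1 - q ^+ k.+1)) *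
  ycoef y k.
Proof.
elim: k => [|k IH].
  by rewrite ycoefS !ycoef0 expr0; ring.
rewrite ycoefS IH [in RHS]ycoefS.
have := den_neq0 k; set d := (_ * (1 - q ^+ k.+1)) => d0.
have := den_neq0 k.+1; set d1 := (_ * (1 - q ^+ k.+2)) => d10.
by rewrite exprS; field; rewrite d0 d10.
Qed.

Lemma ycoef_shift_down y k : (1 - y) * ycoef (y / q) k.+1 =
  (q ^+ k.+1)^-1 * (q ^+ k - y) * (q ^+ k.+1 - y) * q /
    ((1 + a * q ^+ (2 * k + 2)) * (1 - q ^+ k.+1)) * ycoef y k.
Proof.
elim: k => [|k IH].
  rewrite ycoefS !ycoef0 expr0.
  have := den_neq0 0; set d := (_ * (1 - q ^+ 1)) => d0.
  by rewrite expr1; field; rewrite d0 q_neq0.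
rewrite ycoefS [LHS]mulrA IH [in RHS]ycoefS.
have := den_neq0 k; set d := (_ * (1 - q ^+ k.+1)) => d0.
have := den_neq0 k.+1; set d1 := (_ * (1 - q ^+ k.+2)) => d10.
by rewrite [q ^+ k.+2]exprS [q ^+ k.+1]exprS; field; rewrite d0 d10 q_neq0 qn_neq0.
Qed.

Lemma ycoef_difference y k : y != 0 ->
  diff_up y * (ycoef (q * y) k.+1 - ycoef y k.+1) +
  diff_down y * (ycoef (y / q) k.+1 - ycoef y k.+1) =
  (q ^+ k.+1)^-1 * (1 - a * q ^+ (2 * k.+1 + 1)) * ycoef y k.+1 -
  (q ^+ k)^-1 * ycoef y k - lattice 0 * ycoef y k.+1.
Proof.
move=> y0; have h := ycoef_shift_down y k.
have -> : diff_down y * (ycoef (y / q) k.+1 - ycoef y k.+1) =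
   - (1 + y) / y ^+ 2 * ((1 - y) * ycoef (y / q) k.+1) - diff_down y * ycoef y k.+1.
  by rewrite /diff_down; field.
rewrite h ycoef_shift_up ycoefS /diff_up /diff_down /lattice expr0.
rewrite expq1 expq2 [q ^+ k.+1]exprS.
have D2 : 1 - q * q ^+ k != 0 by rewrite -exprS gt_eqF// subr_gt0.
have D1 : 1 + a * (q * q ^+ k) ^+ 2 != 0 by rewrite gt_eqF// one_plus_gt0 ?sqr_ge0.
by field; rewrite D1 D2 qn_neq0 q_neq0 y0.
Qed.

Lemma sum_difference x y K : y != 0 ->
  \sum_(k < K.+1) (diff_up y * (ycoef (q * y) k - ycoef y k) +
      diff_down y * (ycoef (y / q) k - ycoef y k)) * xbasis (q ^+ x) k =
  (lattice x - lattice 0) * (\sum_(k < K.+1) ycoef y k * xbasis (q ^+ x) k) +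
  (q ^+ K)^-1 * ycoef y K * xbasis (q ^+ x) K.+1.
Proof.
move=> y0; elim: K => [|K IH].
  rewrite !big_ord_recl !big_ord0 !ycoef0 !subrr !mulr0 !addr0 mul0r.
  have := xbasis_mul_lattice x 0.
  rewrite expq1 expr0 invr1 xbasis0 !mul1r !mulr1 expr1n mulr1 => ->.
  by rewrite /lattice expr0 invr1; ring.
rewrite big_ord_recr/= IH ycoef_difference// [in RHS]big_ord_recr/=.
set S := \sum_(i < _) _.
have := xbasis_mul_lattice x K.+1; set P := xbasis _ K.+1 => h.
have -> : (lattice x - lattice 0) * (S + ycoef y K.+1 * P) =
  (lattice x - lattice 0) * S + ycoef y K.+1 * (lattice x * P) -
  ycoef y K.+1 * lattice 0 * P by ring.
by rewrite h; ring.
Qed.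

(** The three-term recurrence of the polynomials, read as an eigenvalue
    equation in [n]; [diff_down] vanishes at [n = 0]. *)
Lemma Dval_difference x n : (lattice x - lattice 0) * Dval x n =
  diff_up (q ^+ n) * (Dval x n.+1 - Dval x n) +
  diff_down (q ^+ n) * (Dval x n.-1 - Dval x n).
Proof.
have nK : (n < n.+2)%N by rewrite ltnS leqnSn.
have nK' : (n.-1 < n.+2)%N by rewrite (leq_ltn_trans (leq_pred n)).
have := sum_difference x n.+1 (qn_neq0 n).
rewrite -(Dval_expansion x nK) ycoef_eq0// mulr0 mul0r addr0 => <-.
rewrite (Dval_expansion x nK) (Dval_expansion x (ltnSn n.+1)).
rewrite (Dval_expansion x nK') -!sumrB !mulr_sumr -big_split/=.
apply: eq_bigr => k _; rewrite mulrDl exprS; congr (_ + _); first by ring.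
case: n {nK nK'} k => [|n] k; first by rewrite /diff_down expr1n subrr oppr0 !mul0r.
by rewrite /= exprS [q * _ / q]mulrAC divff// mul1r; ring.
Qed.

(** The weight on the degrees [n] for which the functions [Dval x] of one
    parity are orthogonal; it is proportional to the inverse of
    [Dtilde_norm2 q a n], see [Dtilde_norm2E]. *)
Definition dual_weight n : R :=
  qpoch (- a * q ^+ 2) (q ^+ 2) n * q ^+ n / qpoch (q ^+ 2) (q ^+ 2) n.

Lemma dual_weight_gt0 n : 0 < dual_weight n.
Proof.
rewrite /dual_weight divr_gt0 ?mulr_gt0//.
  by rewrite mulNr qpoch_neg_gt0// ?mulr_ge0 ?exprn_ge0 ?ltW.
by rewrite qpoch_gt0// ?exprn_ge0 ?qn_le1 ?qS_lt1 ?ltW.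
Qed.

Lemma qpochS (x p : R) n : qpoch x p n.+1 = qpoch x p n * (1 - x * p ^+ n).
Proof. by rewrite /qpoch big_ord_recr. Qed.

Let one_minus_neq0 n : 1 - (q * q ^+ n) ^+ 2 != 0.
Proof. by rewrite -exprS gt_eqF// subr_gt0 exprn_ilt1// ltW. Qed.

Lemma dual_weightS n : dual_weight n.+1 =
  dual_weight n * (q * (1 + a * (q * q ^+ n) ^+ 2) / (1 - (q * q ^+ n) ^+ 2)).
Proof.
rewrite /dual_weight !qpochS -!exprM [(2 * n)%N]mulnC exprM [q ^+ n.+1]exprS.
have h1 := one_minus_neq0 n; have h1' := h1; rewrite exprMn in h1'.
have h2 : qpoch (q ^+ 2) (q ^+ 2) n != 0.
  by rewrite gt_eqF// qpoch_gt0// ?exprn_ge0 ?qn_le1 ?qS_lt1 ?ltW.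
by field; rewrite h2 h1.
Qed.

Lemma dual_weight0 : dual_weight 0 = 1.
Proof. by rewrite /dual_weight /qpoch !big_ord0 expr0 mul1r divff ?oner_neq0. Qed.

Lemma dual_weight_symmetry n :
  dual_weight n.+1 * diff_down (q ^+ n.+1) = dual_weight n * diff_up (q ^+ n).
Proof.
rewrite dual_weightS /diff_down /diff_up [q ^+ n.+1]exprS; field.
by rewrite !qn_neq0 q_neq0 one_minus_neq0.
Qed.

(** Summation by parts: the difference operator in [n] is symmetric for
    [dual_weight], up to a boundary term. *)
Lemma sum_telescope x N :
  (lattice x - lattice 0) * (\sum_(n < N.+1) dual_weight n * Dval x n) =
  dual_weight N * diff_up (q ^+ N) * (Dval x N.+1 - Dval x N).
Proof.
have E n : (lattice x - lattice 0) * (dual_weight n * Dval x n) = dual_weight n *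
    (diff_up (q ^+ n) * (Dval x n.+1 - Dval x n) +
     diff_down (q ^+ n) * (Dval x n.-1 - Dval x n)).
  by rewrite -Dval_difference; ring.
have C0 : diff_down (q ^+ 0) = 0 by rewrite /diff_down !expr0 expr1n subrr oppr0 mul0r.
elim: N => [|N IH]; first by rewrite big_ord1/= E C0 mul0r addr0 mulrA.
rewrite big_ord_recr/= mulrDr IH E/= -dual_weight_symmetry.
move: (Dval x N) (Dval x N.+1) (Dval x N.+2) (diff_up _) (diff_down _).
by move: (dual_weight _) => *; ring.
Qed.

Lemma Dval0 n : Dval 0 n = 1.
Proof.
rewrite (Dval_expansion 0 (ltnSn n)) big_ord_recl ycoef0 xbasis0 mulr1 big1 ?addr0// => k _.
by rewrite /xbasis big_ord_recl/= !expr0 divr1 subrr !mul0r mulr0.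
Qed.

Lemma Dval1 n : Dval 1 n = q ^+ n.
Proof.
have := Dval_recurrence 0 n; rewrite rec_down0 mul0r addr0 Dval0 mulr1 => ->.
by rewrite -[rec_up 0]addr0 -rec_down0 rec_up_down mul1r.
Qed.

(** [Dval x] is a polynomial in [q ^+ n] of the parity of [x],
    whence these bounds; the second one for even [x] makes the boundary term of
    [sum_telescope] vanish in the limit. *)
Lemma Dval_bounds x : exists C, 0 <= C /\ forall n,
  if odd x then is_true (`|Dval x n| <= C * q ^+ n)
  else `|Dval x n| <= C /\ `|Dval x n.+1 - Dval x n| <= C * (q ^+ n) ^+ 2.
Proof.
have uS m n : Dval m.+2 n = (q ^+ n * Dval m.+1 n - rec_down m.+1 * Dval m n) / rec_up m.+1.
  by rewrite Dval_recurrence/= addrK mulrAC divff ?mul1r// gt_eqF// rec_up_gt0.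
suff : forall m, (exists C, 0 <= C /\ forall n,
    if odd m then is_true (`|Dval m n| <= C * q ^+ n)
    else `|Dval m n| <= C /\ `|Dval m n.+1 - Dval m n| <= C * (q ^+ n) ^+ 2) /\
   (exists C, 0 <= C /\ forall n,
    if odd m.+1 then is_true (`|Dval m.+1 n| <= C * q ^+ n)
    else `|Dval m.+1 n| <= C /\ `|Dval m.+1 n.+1 - Dval m.+1 n| <= C * (q ^+ n) ^+ 2).
  by move=> /(_ x)[].
elim => [|k [[C [C0 hC]] [D [D0 hD]]]].
  split; exists 1; split => // n /=.
    by rewrite !Dval0 normr1 lexx subrr normr0 mul1r sqr_ge0.
  by rewrite Dval1 ger0_norm ?mul1r// ltW.
split; first by exists D.
have al := rec_up_gt0 k.+1; have ga := rec_downS_gt0 k.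
exists ((rec_down k.+1 * C + 2 * D) / rec_up k.+1); split.
  by apply: divr_ge0 (ltW al); apply: addr_ge0; apply: mulr_ge0 => //; exact: ltW.
move=> n; move: (hC n) (hD n) (hD n.+1) (uS k n) (uS k n.+1).
move: (rec_down k.+1) (rec_up k.+1) al ga => g al al0 g0.
move: (Dval k) (Dval k.+1) (Dval k.+2) => f1 f2 f3.
rewrite /= negbK; case: (odd k) => /=.
  move=> h1 [h2 h3] _ -> _; rewrite normrM normfV (gtr0_norm al0).
  rewrite mulrAC ler_pM2r ?invr_gt0//.
  apply: le_trans (ler_normB _ _) _; rewrite !normrM (gtr0_norm g0).
  rewrite (gtr0_norm (qn_gt0 n)) mulrDl.
  have e1 : q ^+ n * `|f2 n| <= 2 * D * q ^+ n.
    rewrite mulrC ler_wpM2r ?(ltW (qn_gt0 n))//; lra.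
  have e2 : g * `|f1 n| <= g * C * q ^+ n by rewrite -mulrA ler_pM2l.
  lra.
move=> [h1 h2] h3 h4 e3 e4.
have y0 := qn_gt0 n; have y1 := qn_le1 n.
split.
  rewrite e3 normrM normfV (gtr0_norm al0) ler_pM2r ?invr_gt0//.
  apply: le_trans (ler_normB _ _) _; rewrite !normrM (gtr0_norm g0).
  rewrite (gtr0_norm y0).
  have e2 : g * `|f1 n| <= g * C by rewrite ler_pM2l.
  have e1 : q ^+ n * `|f2 n| <= 2 * D.
    apply: le_trans (ler_piMl (normr_ge0 _) y1) _; apply: le_trans h3 _.
    by apply: le_trans (ler_piMr D0 y1) _; lra.
  lra.
have -> : f3 n.+1 - f3 n =
    (q ^+ n.+1 * f2 n.+1 - q ^+ n * f2 n - g * (f1 n.+1 - f1 n)) / al.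
  by rewrite e3 e4; ring.
rewrite normrM normfV (gtr0_norm al0) mulrAC ler_pM2r ?invr_gt0//.
apply: le_trans (ler_normB _ _) _; rewrite [X in _ + X]normrM (gtr0_norm g0).
apply: le_trans (lerD (ler_normB _ _) (lexx _)) _.
rewrite !normrM !(gtr0_norm (qn_gt0 _)) mulrDl [leLHS]addrC.
apply: lerD; first by rewrite -mulrA ler_pM2l.
have e1 : q ^+ n * `|f2 n| <= D * (q ^+ n) ^+ 2.
  by rewrite expr2 [leRHS]mulrCA ler_pM2l.
have qy : q ^+ n.+1 <= q ^+ n by rewrite exprS ler_piMl ?ltW.
have e2 : q ^+ n.+1 * `|f2 n.+1| <= D * (q ^+ n) ^+ 2.
  rewrite expr2 [leRHS]mulrCA ler_pM ?(ltW (qn_gt0 _))//.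
  by apply: le_trans h4 _; rewrite ler_wpM2l.
lra.
Qed.

End Recurrences.

(** * The total mass of the dual weight *)

Section QBinomial.
Context (R : realType) (q a : R) (hq : 0 < q < 1) (ha : 0 < a).

Let q_gt0 : 0 < q. Proof. by case/andP: hq. Qed.
Let q_lt1 : q < 1. Proof. by case/andP: hq. Qed.
Let qn_gt0 n : 0 < q ^+ n. Proof. exact: exprn_gt0. Qed.
Let qn_le1 n : q ^+ n <= 1. Proof. by rewrite exprn_ile1// ltW. Qed.
Let qS_lt1 n : q ^+ n.+1 < 1. Proof. by rewrite exprn_ilt1// ltW. Qed.

Local Notation v := (dual_weight q a).

Let v_gt0 n : 0 < v n. Proof. exact: dual_weight_gt0. Qed.

Lemma dual_weight_summable : exists l, has_sum v l.
Proof.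
have c0 : 0 < (1 - q) / 2 / (q * a + (1 + q) / 2).
  by rewrite divr_gt0 ?addr_gt0 ?mulr_gt0// ?divr_gt0 ?subr_gt0 ?addr_gt0.
have q_norm : `|q| < 1 by rewrite gtr0_norm.
have /cvgrPdist_lt/(_ _ c0)[n0 _ hn0] := @cvg_expr R q q_norm.
apply: (@has_sum_ratio R v ((1 + q) / 2) n0) => [n||n nn].
- exact/ltW/v_gt0.
- by rewrite divr_ge0 ?addr_ge0 ?(ltW q_gt0)//= ltr_pdivrMr//; have := q_lt1; lra.
rewrite dual_weightS// mulrC ler_pM2r// -exprS.
have := hn0 n.+1 (leqW nn); rewrite sub0r normrN gtr0_norm//.
have y0 := qn_gt0 n.+1; have := qS_lt1 n.
set y := q ^+ n.+1 => y1.
rewrite ltr_pdivlMr ?addr_gt0 ?mulr_gt0 ?divr_gt0 ?addr_gt0// => h.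
have y2 : y ^+ 2 <= y by rewrite expr2 ler_piMl ?ltW.
have d0 : 0 < 1 - y ^+ 2 by rewrite subr_gt0 (le_lt_trans y2).
rewrite ler_pdivrMr//.
have : y ^+ 2 * (q * a + (1 + q) / 2) <= y * (q * a + (1 + q) / 2).
  by rewrite ler_wpM2r// ltW// addr_gt0 ?mulr_gt0 ?divr_gt0 ?addr_gt0.
lra.
Qed.

(** The sum of all the dual weights. *)
Definition dual_mass : R := limn (series v).

Lemma has_sum_dual_weight : has_sum v dual_mass.
Proof.
by have [l hl] := dual_weight_summable; rewrite /dual_mass (cvg_lim _ hl).
Qed.

Lemma dual_mass_ge1 : 1 <= dual_mass.
Proof.
have := has_sum_ge_partial 1 (fun n => ltW (v_gt0 n)) has_sum_dual_weight.
by rewrite big_ord1 dual_weight0.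
Qed.

Let p := q ^+ 2.

Let moment j : exists l, has_sum (fun n => v n * (p ^+ j) ^+ n) l.
Proof.
have [l hl] := dual_weight_summable.
apply: (has_sum_bounded (C := 1)) hl => n; first exact/ltW/v_gt0.
by rewrite ger0_norm ?exprn_ge0 ?exprn_ile1 ?exprn_ge0 ?ltW// /p exprn_ile1 ?ltW.
Qed.

(* The functional equation [(1 - z) f(z) = (1 - A z) f(p z)] of the q-binomial
   series, at [z = q p^j] and [A = - a q^2]. *)
Let moment_recurrence j l m :
  has_sum (fun n => v n * (p ^+ j) ^+ n) l ->
  has_sum (fun n => v n * (p ^+ j.+1) ^+ n) m ->
  (1 - q * p ^+ j) * l = (1 - (- a * q ^+ 3) * p ^+ j) * m.
Proof.
move=> hl hm.
have h1 := has_sum_shift (has_sumB hl hm).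
have h2 := has_sumZ (q * p ^+ j) (has_sumD hl (has_sumZ (a * q ^+ 2) hm)).
have h : has_sum (fun n => v n.+1 * (p ^+ j) ^+ n.+1 - v n.+1 * (p ^+ j.+1) ^+ n.+1)
   (q * p ^+ j * (l + a * q ^+ 2 * m)).
  apply: has_sum_ext h2 => n /=.
  have -> : (p ^+ j.+1) ^+ n.+1 = p ^+ j.+1 * (p ^+ j.+1) ^+ n by rewrite exprS.
  have -> : (p ^+ j.+1) ^+ n = (p ^+ j) ^+ n * p ^+ n.
    by rewrite [p ^+ j.+1]exprS exprMn mulrC.
  have -> : p ^+ j.+1 = p * p ^+ j by rewrite exprS.
  have -> : (p ^+ j) ^+ n.+1 = p ^+ j * (p ^+ j) ^+ n by rewrite exprS.
  have -> : p ^+ n = (q ^+ n) ^+ 2 by rewrite exprAC.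
  rewrite dual_weightS// /p.
  have : 1 - (q * q ^+ n) ^+ 2 != 0.
    by rewrite -exprS gt_eqF// subr_gt0 exprn_ilt1// ltW.
  by move: (v n) (q ^+ 2 ^+ j) (q ^+ 2 ^+ j ^+ n) (q ^+ n) => x b c d D; field.
have := has_sum_uniq h1 h; rewrite !expr0 subrr subr0 => e.
apply/eqP; rewrite -subr_eq0; apply/eqP.
have -> : (1 - q * p ^+ j) * l - (1 - - a * q ^+ 3 * p ^+ j) * m =
  (l - m) - q * p ^+ j * (l + a * q ^+ 2 * m) by ring.
by rewrite e subrr.
Qed.

Let moment_limit l (j : nat) : has_sum (fun n => v n * (p ^+ j) ^+ n) l ->
  1 <= l <= 1 + p ^+ j * dual_mass.
Proof.
move=> hl; have pj : 0 <= p ^+ j by rewrite !exprn_ge0// ltW.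
apply/andP; split.
  have := has_sum_ge_partial 1 (fun n => mulr_ge0 (ltW (v_gt0 n)) (exprn_ge0 n pj)) hl.
  by rewrite big_ord1 dual_weight0 expr0 mulr1.
have pj1 : p ^+ j <= 1 by rewrite exprn_ile1 ?exprn_ge0 ?qn_le1 ?ltW.
have h1 := has_sumD (@has_sum_finite R (fun n => (n == 0%N)%:R) 1 _)
  (has_sumZ (p ^+ j) has_sum_dual_weight).
rewrite -[X in X + _](_ : \sum_(n < 1) (n == 0%N :> nat)%:R = _); last first.
  by rewrite big_ord1.
apply: has_sum_le hl (h1 _) => [|[]//].
case=> [|n]; first by rewrite dual_weight0 expr0 mulr1 lerDl mulr_ge0.
rewrite /= add0r [leRHS]mulrC ler_pM2l// exprS ler_piMr// exprn_ile1//.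
Qed.

(** The q-binomial theorem. Iterating the functional equation gives
    [(q; p)_N] times the mass as [(- a q^3; p)_N] times the [N]-th moment, which
    tends to [1]. *)
Lemma dual_massE : dual_mass = qpoch_inf (- a * q ^+ 3) p / qpoch_inf q p.
Proof.
have vm0 : 0 < dual_mass by rewrite (lt_le_trans ltr01 dual_mass_ge1).
pose B N := qpoch (- a * q ^+ 3) p N; pose L N := qpoch q p N.
have key N l : has_sum (fun n => v n * (p ^+ N) ^+ n) l ->
    L N * dual_mass = B N * l.
  elim: N l => [|N IH] l hl.
    rewrite /L /B /qpoch !big_ord0 !mul1r; apply: has_sum_uniq has_sum_dual_weight _.
    by apply: has_sum_ext hl => n; rewrite expr0 expr1n mulr1.
  have [m hm] := moment N; have := moment_recurrence hm hl.
  rewrite /L /B !qpochS -/(L N) -/(B N) => h.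
  by rewrite [LHS]mulrAC (IH _ hm) -[LHS]mulrA (mulrC m) h mulrA.
have B1 N : 1 <= B N /\ B N <= B N.+1.
  have pos M : 0 <= - (- a * q ^+ 3) * p ^+ M.
    by rewrite -[- (- a * _)]mulNr opprK !mulr_ge0 ?exprn_ge0 ?exprn_ge0 ?ltW.
  elim: N => [|N [IH1 IH2]].
    rewrite /B qpochS /qpoch big_ord0 mul1r; split=> //.
    by have := pos 0%N; lra.
  split; first exact: le_trans IH2.
  rewrite [leRHS]/B qpochS -/(B _) ler_peMr ?(le_trans ler01 (le_trans IH1 IH2))//.
  by have := pos N.+1; lra.
have L0 N : 0 < L N.
  by rewrite qpoch_gt0// ?q_lt1 ?(qn_le1 2) ?exprn_ge0 ?ltW.
have L1 N : L N <= 1.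
  elim: N => [|N IH]; first by rewrite /L /qpoch big_ord0.
  rewrite [L _]qpochS -/(L _) (le_trans _ IH)// ler_piMr// ?(ltW (L0 _))//.
  by rewrite gerBl mulr_ge0 ?exprn_ge0 ?exprn_ge0 ?ltW.
have Bbd N : B N <= dual_mass.
  have [l hl] := moment N; have /andP[l1 _] := moment_limit hl.
  have Bge : B N <= B N * l by rewrite ler_peMr// (le_trans ler01)//; case: (B1 N).
  by rewrite (le_trans Bge)// -(key _ _ hl) ler_piMl// ltW.
have cB : cvgn B.
  apply: nondecreasing_is_cvgn; first by apply/nondecreasing_seqP => n; case: (B1 n).
  by exists dual_mass => _ [n _ <-]; exact: Bbd.
have hB : B @ \oo --> qpoch_inf (- a * q ^+ 3) p by [].
have Bge1 : 1 <= qpoch_inf (- a * q ^+ 3) p.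
  by apply: limr_ge => //; apply: nearW => n; case: (B1 n).
have hL : L @ \oo --> qpoch_inf (- a * q ^+ 3) p / dual_mass.
  have hp : (fun N => B N * dual_mass^-1 + B N * p ^+ N) @ \oo -->
      qpoch_inf (- a * q ^+ 3) p / dual_mass + qpoch_inf (- a * q ^+ 3) p * 0.
    apply: cvgD; first by apply: cvgM => //; exact: cvg_cst.
    apply: cvgM => //; apply: cvg_expr.
    by rewrite ger0_norm ?exprn_ge0 ?qS_lt1 ?ltW.
  rewrite mulr0 addr0 in hp.
  have hp0 : (fun N => B N * dual_mass^-1) @ \oo -->
      qpoch_inf (- a * q ^+ 3) p / dual_mass by apply: cvgM => //; exact: cvg_cst.
  apply: (squeeze_cvgr _ hp0 hp).
  apply: nearW => N /=; have [l hl] := moment N.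
  have /andP[l1 l2] := moment_limit hl.
  have -> : L N = B N * l / dual_mass by rewrite -(key _ _ hl) mulfK// gt_eqF.
  have B0 : 0 < B N by apply: lt_le_trans ltr01 _; case: (B1 N).
  rewrite -mulrDr -mulrA !ler_pM2l//.
  apply/andP; split; first by rewrite ler_peMl// invr_ge0 ltW.
  by rewrite ler_pdivrMr// mulrDl mulVf// gt_eqF.
rewrite [qpoch_inf q p](cvg_lim (@Rhausdorff R) hL) invfM invrK mulrA divff ?mul1r//.
by rewrite gt_eqF// (lt_le_trans ltr01).
Qed.

Lemma Dtilde_norm2E n : Dtilde_norm2 q a n = dual_mass / dual_weight q a n.
Proof.
rewrite dual_massE /Dtilde_norm2; congr (_ * _).
by rewrite /dual_weight invfM invrK mulrC mulrA mulrAC invfM; ring.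
Qed.

End QBinomial.

(** * Orthogonality in the degree *)

Section Orthogonality.
Context (R : realType) (q a : R) (hq : 0 < q < 1) (ha : 0 < a).

Let q_gt0 : 0 < q. Proof. by case/andP: hq. Qed.
Let q_lt1 : q < 1. Proof. by case/andP: hq. Qed.
Let qn_gt0 n : 0 < q ^+ n. Proof. exact: exprn_gt0. Qed.
Let qn_le1 n : q ^+ n <= 1. Proof. by rewrite exprn_ile1// ltW. Qed.
Let qS_lt1 n : q ^+ n.+1 < 1. Proof. by rewrite exprn_ilt1// ltW. Qed.

Local Notation v := (dual_weight q a).
Local Notation u := (Dval q a).
Local Notation dual_mass := (dual_mass q a).
Local Notation rec_up := (rec_up q a).
Local Notation rec_down := (rec_down q a).
Local Notation lattice := (lattice q a).

Let v_gt0 n : 0 < v n. Proof. exact: dual_weight_gt0. Qed.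

(** Orthogonality to the constant [Dval 0]. *)
Lemma sum_Dval_even x : ~~ odd x.+1 -> has_sum (fun n => v n * u x.+1 n) 0.
Proof.
move=> ex; have [C [C0 hC]] := Dval_bounds hq ha x.+1.
have hx := lattice_neq hq ha x.
rewrite /has_sum -cvg_shiftS.
pose K := (1 + a * q ^+ 2) / q * C / `|lattice x.+1 - lattice 0|.
have hv := has_sum_term (has_sum_dual_weight hq ha).
have h0 : (fun n => K * v n) @ \oo --> K * 0 by apply: cvgM => //; exact: cvg_cst.
rewrite mulr0 in h0.
apply/norm_cvg0P; apply: (squeeze_cvgr _ (cvg_cst 0) h0); apply: nearW => N.
rewrite /= normr_ge0/= /series/= big_mkord.
have := sum_telescope hq ha x.+1 N.
move: hx; set S := \sum_(n < N.+1) _; set d := lattice _ - _ => d0 h.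
have -> : S = v N * diff_up q a (q ^+ N) * (u x.+1 N.+1 - u x.+1 N) / d.
  by rewrite -h mulrC mulKf.
rewrite normrM normfV /K [leRHS]mulrAC ler_pM2r ?invr_gt0 ?normr_gt0//.
rewrite -mulrA normrM (gtr0_norm (v_gt0 N)) [leRHS]mulrC ler_pM2l//.
have := hC N; rewrite (negbTE ex) => -[_]; rewrite normrM.
move: (u _ _ - _) => D hD.
have y0 := qn_gt0 N; have y1 := qn_le1 N; move: (q ^+ N) y0 y1 hD => y y0 y1 hD.
have y2 : 0 < y ^+ 2 by rewrite exprn_gt0.
have -> : `|diff_up q a y| = (1 + a * q ^+ 2 * y ^+ 2) / (q * y ^+ 2).
  rewrite /diff_up mulNr normrN ger0_norm// divr_ge0 ?mulr_ge0 ?ltW//.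
  by rewrite ltr_pwDl// !mulr_ge0 ?ltW.
apply: le_trans (_ : (1 + a * q ^+ 2 * y ^+ 2) / (q * y ^+ 2) * (C * y ^+ 2) <= _).
  rewrite ler_wpM2l// divr_ge0 ?mulr_ge0 ?ltW//.
  by rewrite ltr_pwDl// !mulr_ge0 ?ltW.
have -> : (1 + a * q ^+ 2 * y ^+ 2) / (q * y ^+ 2) * (C * y ^+ 2) =
    (1 + a * q ^+ 2 * y ^+ 2) / q * C by field; rewrite !gt_eqF.
rewrite ler_wpM2r// ler_wpM2r ?invr_ge0 ?(ltW q_gt0)// lerD2l ler_piMr//.
  by rewrite mulr_ge0 ?ltW// exprn_gt0.
by rewrite exprn_ile1// ltW.
Qed.

(** The common form of [even_weight] and [odd_weight]. *)
Definition lattice_weight x : R :=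
  (1 + a * q ^+ (2 * x + 1)) * qpoch (- a * q) q x /
  ((1 + a * q) * qpoch q q x) * q ^+ 'C(x, 2).

Lemma even_weightE k : even_weight q a k = lattice_weight (2 * k).
Proof.
rewrite /even_weight /lattice_weight; congr (_ / _ * q ^+ _).
  by congr ((1 + a * q ^+ _) * _); clear; lia.
by rewrite bin2; case: k => // k; rewrite mulnAC; clear; lia.
Qed.

Lemma odd_weightE k : odd_weight q a k = lattice_weight (2 * k + 1).
Proof.
rewrite /odd_weight /lattice_weight; congr (_ / _ * q ^+ _).
  by congr ((1 + a * q ^+ _) * _); clear; lia.
by rewrite bin2 addn1/=; clear; lia.
Qed.

Lemma lattice_weight_gt0 x : 0 < lattice_weight x.
Proof.
rewrite /lattice_weight mulr_gt0// divr_gt0 ?mulr_gt0//.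
- by rewrite one_plus_gt0// ltW.
- by rewrite mulNr qpoch_neg_gt0// ?mulr_ge0 ?ltW.
- by rewrite one_plus_gt0// ltW.
- by rewrite qpoch_gt0// ?q_lt1 ?ltW.
Qed.

Lemma lattice_weightS x :
  lattice_weight x.+1 * rec_down x.+1 = lattice_weight x * rec_up x.
Proof.
rewrite /lattice_weight /rec_down /rec_up !qpochS binS bin1 [q ^+ ('C(x, 2) + x)]exprD.
have D1 : 1 + a * q ^+ (2 * x + 1) != 0 by rewrite gt_eqF ?one_plus_gt0// ltW.
have D2 : 1 + a * q ^+ (2 * x.+1 + 1) != 0 by rewrite gt_eqF ?one_plus_gt0// ltW.
have D3 : 1 - q * q ^+ x != 0 by rewrite -exprS gt_eqF ?subr_gt0.
have D4 : qpoch q q x != 0 by rewrite gt_eqF// qpoch_gt0// ?q_lt1 ?ltW.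
have D5 : 1 + a * q != 0 by rewrite gt_eqF ?one_plus_gt0// ltW.
rewrite ![q ^+ x.+1]exprS; move: D1 D2 D3 D4.
move: (q ^+ (2 * x + 1)) (q ^+ (2 * x.+1 + 1)) (qpoch _ _ _) (qpoch _ _ _) (q ^+ x) (q ^+ _).
by move=> A B C D E F D1 D2 D3 D4; field; rewrite D5 D4 D3 D2 D1.
Qed.

(* Moving the factor [q ^+ n] from one argument of the inner product to the
   other expresses the product of [x] and [x' + 1] by products with smaller
   second argument. *)
Let gram_dual_step x x' (l1 l2 l3 : R) :
  has_sum (fun n => v n * (u x.+1 n * u x' n)) l1 ->
  has_sum (fun n => rec_down x * (v n * (u x.-1 n * u x' n))) l2 ->
  has_sum (fun n => rec_down x' * (v n * (u x n * u x'.-1 n))) l3 ->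
  has_sum (fun n => v n * (u x n * u x'.+1 n))
    ((rec_up x * l1 + l2 - l3) / rec_up x').
Proof.
move=> h1 h2 h3; have al := rec_up_gt0 hq ha x'.
have h := has_sumZ (rec_up x')^-1 (has_sumB (has_sumD (has_sumZ (rec_up x) h1) h2) h3).
rewrite mulrC; apply: has_sum_ext h => n.
have := Dval_recurrence hq ha x n; have := Dval_recurrence hq ha x' n.
move: (u x n) (u x' n) (u x.+1 n) (u x'.+1 n) (u x.-1 n) (u x'.-1 n).
move=> b b' c c' d d' e' e.
have -> : rec_up x * (v n * (c * b')) + rec_down x * (v n * (d * b')) -
    rec_down x' * (v n * (b * d')) =
    v n * b' * (rec_up x * c + rec_down x * d) - v n * b * (rec_down x' * d').
  by move: (rec_up x) (rec_down x) (rec_down x') (v n) => *; ring.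
rewrite -e; have -> : rec_down x' * d' = q ^+ n * b' - rec_up x' * c'.
  by rewrite e' addrC addKr.
by move: (rec_up x') (v n) al => A V A0; field; rewrite gt_eqF.
Qed.

(** By induction on [x'], with two consecutive values at a time; for [x] and
    [x'] of opposite parity the inner product need not vanish. *)
Lemma gram_dual x x' : (x' <= x)%N -> ~~ odd (x + x') ->
  has_sum (fun n => v n * (u x n * u x' n)) (dual_mass / lattice_weight x * (x == x')%:R).
Proof.
have base y : ~~ odd y ->
    has_sum (fun n => v n * (u y n * u 0 n)) (dual_mass / lattice_weight y * (y == 0)%:R).
  case: y => [_|y /sum_Dval_even h].
    apply: has_sum_eq (has_sum_ext _ (has_sum_dual_weight hq ha)).
      rewrite eqxx mulr1 /lattice_weight /qpoch !big_ord0 bin0n expr0 !mulr1 muln0 add0n expr1.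
      by rewrite divff ?divr1// gt_eqF// one_plus_gt0// ltW.
    by move=> n; rewrite !Dval0// !mulr1.
  rewrite mulr0; apply: has_sum_ext h => n; by rewrite Dval0// mulr1.
suff : forall m,
    (forall y, (m <= y)%N -> ~~ odd (y + m) -> has_sum
      (fun n => v n * (u y n * u m n)) (dual_mass / lattice_weight y * (y == m)%:R)) /\
    (forall y, (m.+1 <= y)%N -> ~~ odd (y + m.+1) -> has_sum
      (fun n => v n * (u y n * u m.+1 n))
        (dual_mass / lattice_weight y * (y == m.+1)%:R)).
  by move=> /(_ x')[h _]; exact: h.
have step m : (forall y, (m <= y)%N -> ~~ odd (y + m) -> has_sum
      (fun n => v n * (u y n * u m n)) (dual_mass / lattice_weight y * (y == m)%:R)) ->
    (forall y, (m < y)%N -> ~~ odd (y + m.+1) -> has_sum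
      (fun n => rec_down m * (v n * (u y n * u m.-1 n))) 0) ->
    (forall y, (m.+1 <= y)%N -> ~~ odd (y + m.+1) -> has_sum
      (fun n => v n * (u y n * u m.+1 n))
        (dual_mass / lattice_weight y * (y == m.+1)%:R)).
  move=> h1 h2 [//|y] my oy.
  have hA := h1 y.+2 (leqW (leqW my)) _.
  have hB := has_sumZ (rec_down y.+1) (h1 y my _).
  have oy' : ~~ odd (y + m) by move: oy; rewrite !oddD/= addbN addNb negbK.
  apply: has_sum_eq (gram_dual_step (hA _) (hB _) (h2 _ _ oy)) => //; last first.
    by rewrite !addSn/= negbK.
  rewrite gtn_eqF ?ltnS ?leqW// mulr0 mulr0 add0r subr0 eqSS.
  have [<-|_] := eqVneq y m; last by rewrite !mulr0 mul0r.
  rewrite !mulr1; have := lattice_weightS y.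
  have := lattice_weight_gt0 y; have := lattice_weight_gt0 y.+1; have := rec_up_gt0 hq ha y.
  have := rec_downS_gt0 hq ha y.
  move: (rec_down y.+1) (rec_up y) (lattice_weight y) (lattice_weight y.+1) dual_mass.
  move=> g A w w' F g0 A0 w0 w0' e.
  have -> : w' = w * A / g by rewrite -e mulfK// gt_eqF.
  by field; rewrite !gt_eqF.
elim => [|m [IH1 IH2]]; split=> //.
- by move=> y _; rewrite addn0; exact: base.
- apply: step => [y _|y _ _]; first by rewrite addn0; exact: base.
  apply: has_sum_ext (@has_sum0 R) => n; by rewrite rec_down0 mul0r.
- apply: step => // y my oy.
  have h : has_sum (fun n => v n * (u y n * u m n)) 0.
    apply: has_sum_eq (IH1 y (ltnW (ltnW my)) _).
      by rewrite gtn_eqF ?mulr0// ltnW.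
    by move: oy; rewrite !addnS/= negbK.
  by have := has_sumZ (rec_down m.+1) h; rewrite mulr0.
Qed.

Lemma gram_dual_parity e i j : has_sum (fun n => v n * (u (2 * i + e) n * u (2 * j + e) n))
  (dual_mass / lattice_weight (2 * i + e) * (i == j)%:R).
Proof.
have eE : (i == j) = (2 * i + e == 2 * j + e)%N by apply/eqP/eqP; lia.
have par : ~~ odd (2 * i + e + (2 * j + e)) by lia.
rewrite eE; have [ji|/ltnW ij] := leqP (2 * j + e) (2 * i + e); first exact: gram_dual.
have := gram_dual ij; rewrite addnC => /(_ par); rewrite eq_sym.
have [->|ne] := eqVneq (2 * i + e)%N (2 * j + e)%N => //; rewrite !mulr0.
by apply: has_sum_ext => n; rewrite [u _ n * _]mulrC.
Qed.

End Orthogonality.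

Arguments gram_dual_parity {R q a} hq ha e i j.

(** * Completeness of each parity class *)

Section Span.
Context (R : realType) (U : nat -> nat -> R).

(** [g] is a linear combination of [U 0, ..., U (M - 1)]. *)
Definition in_span M (g : nat -> R) : Prop :=
  exists c : nat -> R, forall n, g n = \sum_(i < M) c i * U i n.

Lemma in_span_ext M f g : f =1 g -> in_span M f -> in_span M g.
Proof. by move=> /funext ->. Qed.

Lemma in_spanD M f g : in_span M f -> in_span M g ->
  in_span M (fun n => f n + g n).
Proof.
move=> [c hc] [d hd]; exists (fun i => c i + d i) => n.
by rewrite hc hd -big_split; apply: eq_bigr => i _ /=; rewrite mulrDl.
Qed.

Lemma in_spanZ M (r : R) f : in_span M f -> in_span M (fun n => r * f n).
Proof.
move=> [c hc]; exists (fun i => r * c i) => n.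
by rewrite hc mulr_sumr; apply: eq_bigr => i _; rewrite mulrA.
Qed.

Lemma in_span0 M : in_span M (fun=> 0).
Proof. by exists (fun=> 0) => n; rewrite big1// => i _; rewrite mul0r. Qed.

Lemma in_span_sum M K (G : nat -> nat -> R) :
  (forall i, (i < K)%N -> in_span M (G i)) ->
  in_span M (fun n => \sum_(i < K) G i n).
Proof.
elim: K => [_|K IH hG].
  apply: in_span_ext (in_span0 M) => n; by rewrite big_ord0.
have h1 : in_span M (fun n => \sum_(i < K) G i n).
  by apply: IH => i iK; apply: hG; exact: ltnW.
apply: in_span_ext (in_spanD h1 (hG K (ltnSn K))) => n.
by rewrite big_ord_recr.
Qed.

Lemma in_span_basis M i : (i < M)%N -> in_span M (U i).
Proof.
move=> iM; exists (fun j => (j == i)%:R) => n.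
rewrite (bigD1 (Ordinal iM))//= eqxx mul1r big1 ?addr0// => j.
by rewrite -val_eqE/= => /negbTE ->; rewrite mul0r.
Qed.

Lemma in_spanW M K g : (M <= K)%N -> in_span M g -> in_span K g.
Proof.
move=> MK [c hc]; apply: in_span_ext (_ : in_span K (fun n => \sum_(i < M) c i * U i n)).
  by move=> n; rewrite hc.
apply: (in_span_sum (G := fun i n => c i * U i n)) => i iM.
by apply: in_spanZ; apply: in_span_basis; exact: leq_trans MK.
Qed.

End Span.

Lemma eventually_nonincreasing_bounded (R : realType) (b : nat -> R) M0 :
  (forall M, 0 <= b M) -> (forall M, (M0 <= M)%N -> b M.+1 <= b M) ->
  exists C, forall M, b M <= C.
Proof.
move=> b0 hb; exists (\sum_(i < M0.+1) b i) => M.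
have le_sum i : (i <= M0)%N -> b i <= \sum_(i < M0.+1) b i.
  move=> iM; rewrite (bigD1 (Ordinal (iM : (i < M0.+1)%N)))//= lerDl.
  by apply: sumr_ge0.
have [/le_sum//|/ltnW MM] := leqP M M0.
rewrite -(subnKC MM); elim: (M - M0)%N => [|k IH].
  by rewrite addn0; exact: le_sum.
by rewrite addnS (le_trans (hb _ (leq_addr _ _))).
Qed.

Section Completeness.
Context (R : realType) (q a : R) (hq : 0 < q < 1) (ha : 0 < a).

Let q_gt0 : 0 < q. Proof. by case/andP: hq. Qed.
Let q_lt1 : q < 1. Proof. by case/andP: hq. Qed.
Let qn_gt0 n : 0 < q ^+ n. Proof. exact: exprn_gt0. Qed.
Let qn_le1 n : q ^+ n <= 1. Proof. by rewrite exprn_ile1// ltW. Qed.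

Local Notation v := (dual_weight q a).
Local Notation u := (Dval q a).

Let v_gt0 n : 0 < v n. Proof. exact: dual_weight_gt0. Qed.

Lemma Dval_recurrence2 x n : (q ^+ n) ^+ 2 * u x n =
  rec_up q a x * rec_up q a x.+1 * u x.+2 n +
  (rec_up q a x * rec_down q a x.+1 + rec_down q a x * rec_up q a x.-1) * u x n +
  rec_down q a x * rec_down q a x.-1 * u x.-2 n.
Proof.
rewrite expr2 -mulrA (Dval_recurrence hq ha) mulrDr.
rewrite [X in X + _]mulrCA [X in _ + X]mulrCA [in X in X + _](Dval_recurrence hq ha) /=.
have -> : rec_down q a x * (q ^+ n * u x.-1 n) =
    rec_down q a x * (rec_up q a x.-1 * u x n + rec_down q a x.-1 * u x.-2 n).
  rewrite (Dval_recurrence hq ha); case: x => [|x] //; by rewrite rec_down0 !mul0r.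
by rewrite !mulrDr !mulrA mulrDl !addrA.
Qed.

(* [e] is the parity. *)
Variable e : nat.
Hypothesis e_le1 : (e <= 1)%N.

(** The functions of [n] attached to the lattice points [x = 2 i + e]. *)
Definition parity_class i n := u (2 * i + e) n.

Lemma parity_class_mul_span i M : (i < M)%N ->
  in_span parity_class M.+1 (fun n => (q ^+ n) ^+ 2 * parity_class i n).
Proof.
move=> iM.
have span_up : in_span parity_class M.+1 (u (2 * i + e).+2).
  have -> : (2 * i + e).+2 = (2 * i.+1 + e)%N by lia.
  exact: (@in_span_basis R parity_class).
have span_mid : in_span parity_class M.+1 (u (2 * i + e)).
  by apply: (@in_span_basis R parity_class); exact: ltnW.
(* For [i = 0] the lowest term disappears, since [rec_down 0 = 0]. *)
have span_down : in_span parity_class M.+1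
    (fun n => rec_down q a (2 * i + e) * rec_down q a (2 * i + e).-1 * u (2 * i + e).-2 n).
  case: i iM {span_up span_mid} => [|i] iM.
    apply: in_span_ext (in_span0 _ _) => n.
    by case: e e_le1 => [|[|//]] _; rewrite rec_down0 ?mulr0 !mul0r.
  have -> : (2 * i.+1 + e).-2 = (2 * i + e)%N by lia.
  apply: in_spanZ; apply: (@in_span_basis R parity_class); lia.
pose x := (2 * i + e)%N.
apply: in_span_ext (in_spanD (in_spanD
  (in_spanZ (rec_up q a x * rec_up q a x.+1) span_up)
  (in_spanZ (rec_up q a x * rec_down q a x.+1 + rec_down q a x * rec_up q a x.-1) span_mid))
  span_down) => n.
by rewrite /= /parity_class Dval_recurrence2.
Qed.

Lemma parity_class_span_mul M (r : R) g : in_span parity_class M g ->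
  in_span parity_class M.+1 (fun n => ((q ^+ n) ^+ 2 - r) * g n).
Proof.
move=> hg; have [c hc] := hg.
have h1 : in_span parity_class M.+1
    (fun n => \sum_(i < M) c i * ((q ^+ n) ^+ 2 * parity_class i n)).
  apply: (in_span_sum (G := fun i n => c i * ((q ^+ n) ^+ 2 * parity_class i n))) => i iM.
  by apply: in_spanZ; exact: parity_class_mul_span.
apply: in_span_ext (in_spanD h1 (in_spanZ (- r) (in_spanW (leqnSn M) hg))) => n.
have -> : \sum_(i < M) c i * ((q ^+ n) ^+ 2 * parity_class i n) = (q ^+ n) ^+ 2 * g n.
  by rewrite hc mulr_sumr; apply: eq_bigr => i _; rewrite mulrCA.
by rewrite mulrDl.
Qed.

Variable N : nat.

(** The Lagrange interpolation polynomial in [(q ^+ n) ^+ 2], times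
    [(q ^+ n) ^+ e], which is [1] at [N] and vanishes at the other [n < M]. *)
Fixpoint lagrange M n : R :=
  if M is M'.+1 then
    if M' == N then lagrange M' n
    else lagrange M' n *
      (((q ^+ n) ^+ 2 - (q ^+ M') ^+ 2) / ((q ^+ N) ^+ 2 - (q ^+ M') ^+ 2))
  else (q ^+ n / q ^+ N) ^+ e.

(** A bound of [lagrange M] on the integers at least [M]. *)
Fixpoint lagrange_bound M : R :=
  if M is M'.+1 then
    if M' == N then lagrange_bound M'
    else lagrange_bound M' *
      ((q ^+ M') ^+ 2 / `|(q ^+ N) ^+ 2 - (q ^+ M') ^+ 2|)
  else (q ^+ N) ^- e.

Let node_neq M : M != N -> (q ^+ N) ^+ 2 - (q ^+ M) ^+ 2 != 0.
Proof.
move=> MN; rewrite subr_eq0 eqrXn2// ?ltW//.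
have [MN'|MN'|E] := ltngtP M N; last by rewrite E eqxx in MN.
  by rewrite lt_eqF// ltr_iXn2l.
by rewrite gt_eqF// ltr_iXn2l.
Qed.

Lemma lagrange_span M : in_span parity_class M.+1 (lagrange M).
Proof.
elim: M => [|M IH] /=.
  have h : in_span parity_class 1 (u e) by apply: (@in_span_basis R parity_class 1 0).
  apply: in_span_ext (in_spanZ ((q ^+ N) ^- e) h) => n.
  case: e e_le1 => [|[|//]] _; first by rewrite !expr0 Dval0// invr1 mulr1.
  by rewrite !expr1 Dval1// mulrC.
case: eqP => _; first exact: in_spanW IH.
apply: in_span_ext (in_spanZ ((q ^+ N) ^+ 2 - (q ^+ M) ^+ 2)^-1
  (parity_class_span_mul ((q ^+ M) ^+ 2) IH)) => n.
by rewrite mulrC [RHS]mulrCA mulrA.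
Qed.

Lemma lagrange_self M : lagrange M N = 1.
Proof.
elim: M => [|M IH] /=; first by rewrite divff ?expr1n// gt_eqF.
by case: eqVneq => // MN; rewrite IH mul1r divff// node_neq.
Qed.

Lemma lagrange_other M n : (n < M)%N -> n != N -> lagrange M n = 0.
Proof.
elim: M => // M IH; rewrite ltnS leq_eqVlt => /predU1P[-> /= /negbTE ->|nM nN /=].
  by rewrite subrr mul0r mulr0.
by case: eqP; rewrite IH// mul0r.
Qed.

Lemma lagrange_bound_ge0 M : 0 <= lagrange_bound M.
Proof.
elim: M => [|M IH] /=; first by rewrite invr_ge0 !exprn_ge0// ltW.
by case: eqP => // _; rewrite mulr_ge0// divr_ge0// sqr_ge0.
Qed.

Lemma lagrange_le M n : (M <= n)%N -> `|lagrange M n| <= lagrange_bound M.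
Proof.
elim: M => [_|M IH Mn] /=.
  rewrite ger0_norm ?exprn_ge0 ?divr_ge0 ?(ltW (qn_gt0 _))//.
  rewrite exprMn exprVn ler_piMl//.
    by rewrite invr_ge0 exprn_ge0// ltW.
  by rewrite exprn_ile1 ?qn_le1// ltW.
have [_|_] := eqVneq M N; first exact: IH (ltnW Mn).
rewrite normrM ler_pM//; first exact: IH (ltnW Mn).
rewrite normrM normfV ler_wpM2r ?invr_ge0//.
have h : (q ^+ n) ^+ 2 <= (q ^+ M) ^+ 2.
  by apply: lerXn2r; rewrite ?nnegrE ?(ltW (qn_gt0 _))// ler_iXn2l// ltnW.
by rewrite distrC ger0_norm ?subr_ge0// gerBl sqr_ge0.
Qed.

(** The factors of [lagrange_bound] tend to zero, hence are eventually at most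
    one. *)
Lemma lagrange_bound_bounded : exists C, forall M, lagrange_bound M <= C.
Proof.
have c0 : 0 < (q ^+ N) ^+ 2 / 2 by rewrite divr_gt0// exprn_gt0.
have q_norm : `|q| < 1 by rewrite gtr0_norm.
have /cvgrPdist_lt/(_ _ c0)[n0 _ hn0] := @cvg_expr R q q_norm.
apply: (@eventually_nonincreasing_bounded R _ n0); first exact: lagrange_bound_ge0.
move=> M MM /=; case: eqP => // _; rewrite ler_piMr ?lagrange_bound_ge0//.
have := hn0 M MM; rewrite sub0r normrN gtr0_norm// => h.
have y2 : (q ^+ M) ^+ 2 <= q ^+ M by rewrite expr2 ler_piMl ?(ltW (qn_gt0 _)).
rewrite ler_pdivrMr ?mul1r; last by rewrite normr_gt0 subr_eq0 gt_eqF//; lra.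
by rewrite ger0_norm; lra.
Qed.

(** The unit vector at [N] is approximated by [lagrange M], the squared error
    being at most a constant times the tail of the dual weights beyond [M]. *)
Lemma parity_class_complete (eps : R) : 0 < eps -> exists (M : nat) (c : nat -> R) l,
  has_sum (fun n => v n * ((n == N)%:R - \sum_(i < M) c i * parity_class i n) ^+ 2) l
  /\ l < eps.
Proof.
move=> eps0; have [C hC] := lagrange_bound_bounded.
have C0 : 0 <= C by exact: le_trans (lagrange_bound_ge0 0) (hC 0%N).
have hv := has_sum_dual_weight hq ha.
have C2 : 0 < C ^+ 2 + 1 by rewrite ltr_pwDr// sqr_ge0.
have [M0 hM0] := has_sum_tail hv (divr_gt0 eps0 C2).
pose M := maxn M0 N.+1.
have [c hc] := lagrange_span M.
pose t n := if (n < M)%N then v n else 0.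
have ht : has_sum t (\sum_(n < M) v n).
  have -> : \sum_(n < M) v n = \sum_(n < M) t n.
    by apply: eq_bigr => n _; rewrite /t ltn_ord.
  by apply: has_sum_finite => n; rewrite /t leqNgt => /negbTE ->.
have hd := has_sumZ (C ^+ 2) (has_sumB hv ht).
have dom n : 0 <= v n * ((n == N)%:R - \sum_(i < M.+1) c i * parity_class i n) ^+ 2 <=
    C ^+ 2 * (v n - t n).
  rewrite mulr_ge0 ?sqr_ge0 ?(ltW (v_gt0 n))//= -hc /t.
  have [nM|Mn] := ltnP n M.
    rewrite subrr mulr0; have [->|nN] := eqVneq n N.
      by rewrite lagrange_self subrr expr0n mulr0.
    by rewrite lagrange_other// subrr expr0n mulr0.
  rewrite gtn_eqF ?sub0r ?subr0; last by apply: leq_trans Mn; rewrite leq_maxr.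
  rewrite mulrC ler_wpM2r ?(ltW (v_gt0 n))// sqrrN -real_normK ?num_real//.
  by rewrite lerXn2r ?nnegrE// (le_trans (lagrange_le Mn)).
have [l hl] := has_sum_dominated dom hd.
exists M.+1, c, l; split=> //.
apply: le_lt_trans (has_sum_le (fun n => proj2 (andP (dom n))) hl hd) _.
have := hM0 M (leq_maxl _ _).
rewrite ltr_pdivlMr// => h; apply: le_lt_trans h.
rewrite mulrC; apply: le_trans (ler_norm _) _; rewrite normrM.
by rewrite ler_wpM2l// ger0_norm ?sqr_ge0// lerDl.
Qed.

End Completeness.

(** * Discrete measures and extremality *)

Section DiscreteMeasure.
Context (R : realType) (x w : nat -> R) (w_ge0 : forall k, 0 <= w k).

Local Notation m := (discrete_measure x w_ge0).

Lemma integral_discrete_ge0 (f : R -> R) : measurable_fun setT f ->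
  (forall y, 0 <= f y) ->
  (\int[m]_y (f y)%:E = \sum_(0 <= k <oo) (w k * f (x k))%:E)%E.
Proof.
move=> mf f0; have mEf := (measurable_EFinP _ _).2 mf.
rewrite /discrete_measure ge0_integral_measure_series//; last first.
  by move=> t _; rewrite lee_fin.
apply: eq_eseriesr => k _.
rewrite ge0_integral_mscale//; last by move=> t _; rewrite lee_fin.
by rewrite integral_dirac// diracT mul1e.
Qed.

Lemma integral_discrete (f : R -> R) l : measurable_fun setT f ->
  (forall y, 0 <= f y) -> has_sum (fun k => w k * f (x k)) l ->
  (\int[m]_y (f y)%:E = l%:E)%E.
Proof.
move=> mf f0 hf; rewrite integral_discrete_ge0//.
apply: cvg_lim => //.
have -> : (fun n => (\sum_(0 <= k < n) (w k * f (x k))%:E)%E) =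
    EFin \o series (fun k => w k * f (x k)).
  by apply/funext => n; rewrite /series/= sumEFin.
by apply: cvg_EFin => //; exact: nearW.
Qed.

Lemma integrable_discrete (f : R -> R) l : measurable_fun setT f ->
  (forall y, 0 <= f y) -> has_sum (fun k => w k * f (x k)) l ->
  m.-integrable setT (EFin \o f).
Proof.
move=> mf f0 hf; apply/integrableP; split; first exact/measurable_EFinP.
under eq_integral do rewrite /= ger0_norm//.
by rewrite (integral_discrete mf f0 hf) ltry.
Qed.

Lemma Lnorm_discrete (f : R -> R) l : measurable_fun setT f ->
  has_sum (fun k => w k * f (x k) ^+ 2) l ->
  ('N[m]_2%:E[(fun y => (f y)%:E)] = (l `^ 2^-1)%:E)%E.
Proof.
move=> mf hf; rewrite unlock /Lnorm -poweR_EFin.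
rewrite -(integral_discrete (f := fun y => f y ^+ 2) _ _ hf); last 2 first.
- exact: measurable_funX.
- by move=> y; rewrite sqr_ge0.
congr (_ `^ _)%E; apply: eq_integral => y _.
by rewrite abse_EFin poweR_EFin powR_mulrn// real_normK// num_real.
Qed.

Lemma Lfun_discrete (f : R -> R) l : measurable_fun setT f ->
  has_sum (fun k => w k * f (x k) ^+ 2) l -> f \in Lfun m 2%:E.
Proof.
move=> mf hf; rewrite inE; apply/andP; split; first by rewrite inE.
by rewrite inE/= /finite_norm (Lnorm_discrete mf hf) ltry.
Qed.

Lemma Lfun_discrete_measurable (f : R -> R) : f \in Lfun m 2%:E ->
  measurable_fun setT f.
Proof. by rewrite inE => /andP[]; rewrite inE. Qed.

Lemma Lfun_discrete_sum (f : R -> R) : f \in Lfun m 2%:E ->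
  exists s, has_sum (fun k => w k * f (x k) ^+ 2) s.
Proof.
move=> lf; have mf := Lfun_discrete_measurable lf.
have /integrableP[_] := Lfun2_integrable_sqr lf.
under eq_integral do rewrite /= ger0_norm ?sqr_ge0//.
rewrite integral_discrete_ge0//; last 2 first.
- exact: measurable_funX.
- by move=> y; rewrite sqr_ge0.
move=> /nnseries_is_cvg h; exists (limn (series (fun k => w k * f (x k) ^+ 2))).
by apply: h => k; rewrite mulr_ge0// sqr_ge0.
Qed.

(** A discrete orthogonality measure is extremal as soon as the dual
    orthogonality relation holds. *)
Lemma extremal_discrete (P : nat -> {poly R}) (H : nat -> R) :
  (forall k, 0 < w k) -> (forall i, 0 < H i) ->
  (forall i j, has_sum (fun k => w k * ((P i).[x k] * (P j).[x k]))
                 (H i * (i == j)%:R)) ->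
  (forall k l, has_sum (fun i => (P i).[x k] * (P i).[x l] / H i)
                 ((k == l)%:R / w k)) ->
  extremal m P.
Proof.
move=> w0 H0 orth dual.
have sq n : has_sum (fun k => w k * (P n).[x k] ^+ 2) (H n).
  by have := orth n n; rewrite eqxx mulr1.
have mP n : measurable_fun setT (fun y => (P n).[y]) by exact: measurable_poly.
split; first split.
- by move=> n; exact: Lfun_discrete (mP _) (sq n).
- move=> n n' nn'; have hnn' := orth n n'; rewrite (negbTE nn') mulr0 in hnn'.
  (* The product is a difference [f1 - f2] of nonnegative functions. *)
  pose f1 y := 2^-1 * ((P n).[y] + (P n').[y]) ^+ 2.
  pose f2 y := 2^-1 * ((P n).[y] ^+ 2 + (P n').[y] ^+ 2).
  have mf1 : measurable_fun setT f1.
    by apply: measurable_funM => //; apply: measurable_funX; exact: measurable_funD.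
  have mf2 : measurable_fun setT f2.
    by apply: measurable_funM => //; apply: measurable_funD; exact: measurable_funX.
  have f10 y : 0 <= f1 y by rewrite mulr_ge0 ?sqr_ge0.
  have f20 y : 0 <= f2 y by rewrite mulr_ge0 ?addr_ge0 ?sqr_ge0.
  have s2 : has_sum (fun k => w k * f2 (x k)) (2^-1 * (H n + H n')).
    apply: has_sum_ext (has_sumZ 2^-1 (has_sumD (sq n) (sq n'))) => k.
    by rewrite /f2; ring.
  have s1 : has_sum (fun k => w k * f1 (x k)) (2^-1 * (H n + H n')).
    apply: has_sum_eq (has_sum_ext _ (has_sumD s2 hnn')); first by rewrite addr0.
    by move=> k; rewrite /f1 /f2; field.
  have -> : (\int[m]_y ((P n).[y] * (P n').[y])%:E =
      \int[m]_y ((f1 y)%:E - (f2 y)%:E))%E.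
    apply: eq_integral => y _; rewrite -EFinB; congr (_%:E).
    by rewrite /f1 /f2; field.
  rewrite integralB_EFin//; [|exact: integrable_discrete s1|exact: integrable_discrete s2].
  by rewrite (integral_discrete mf1 f10 s1) (integral_discrete mf2 f20 s2) subee.
- move=> n; rewrite (integral_discrete (f := fun y => (P n).[y] ^+ 2) _ _ (sq n)) ?lte_fin//.
  + exact: measurable_funX.
  + by move=> y; rewrite sqr_ge0.
move=> f lf e e0; have [s hs] := Lfun_discrete_sum lf.
have mf := Lfun_discrete_measurable lf.
have [N [c [l [hl le]]]] := approx_l2 w0 H0 orth dual hs (exprn_gt0 2 e0).
exists N, (fun i => c i).
have mg : measurable_fun setT (fun y => f y - \sum_(i < N) c i * (P i).[y]).
  apply: measurable_funB => //; apply: measurable_sum => i.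
  exact: measurable_funM.
rewrite (Lnorm_discrete mg hl) lte_fin.
have l0 : 0 <= l by apply: has_sum_ge0 hl => k; rewrite mulr_ge0 ?sqr_ge0.
rewrite -[ltRHS]gtr0_norm// -sqrtr_sqr powR12_sqrt// ltr_sqrt//.
exact: exprn_gt0.
Qed.

End DiscreteMeasure.

(** * The two orthogonality relations *)

Section Main.
Context (R : realType) (q a : R) (hq : 0 < q < 1) (ha : 0 < a).

Local Notation v := (dual_weight q a).
Local Notation xw := (lattice_weight q a).
Local Notation F := (dual_mass q a).

Lemma dual_mass_gt0 : 0 < F.
Proof. exact: lt_le_trans ltr01 (dual_mass_ge1 hq ha). Qed.

Lemma Dtilde_norm2_gt0 n : 0 < F / v n.
Proof. by rewrite divr_gt0 ?dual_mass_gt0// dual_weight_gt0. Qed.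

Lemma gram_lattice_dual e i j : has_sum
  (fun n => Dval q a (2 * i + e) n * Dval q a (2 * j + e) n / (F / v n))
  ((i == j)%:R / xw (2 * i + e)).
Proof.
have F0 := dual_mass_gt0.
have h := has_sumZ F^-1 (gram_dual_parity hq ha e i j).
apply: has_sum_eq (has_sum_ext _ h).
  by field; rewrite !gt_eqF// lattice_weight_gt0.
by move=> n; move: (Dval q a _ n) (Dval q a _ n) => s t; rewrite invfM invrK; ring.
Qed.

Arguments gram_lattice_dual : clear implicits.

(** The relation dual to [gram_dual_parity], by completeness of the parity
    class. *)
Lemma gram_lattice e : (e <= 1)%N -> forall n n', has_sum
  (fun k => xw (2 * k + e) * (Dval q a (2 * k + e) n * Dval q a (2 * k + e) n'))
  (F / v n * (n == n')%:R).
Proof.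
move=> e1 n n'; have F0 := dual_mass_gt0.
have h := @dual_orthogonality R v (fun i n => Dval q a (2 * i + e) n)
  (fun i => F / xw (2 * i + e)) (dual_weight_gt0 hq ha) _ (gram_dual_parity hq ha e) _ n n'.
apply: has_sum_eq (has_sum_ext _ (has_sumZ F (h _ _))).
- by rewrite mulrCA mulrC.
- move=> k /=; move: (Dval q a _ n) (Dval q a _ n') (lattice_weight_gt0 hq ha (2 * k + e)).
  by move: (xw _) => W s t W0; field; rewrite !gt_eqF.
- by move=> k; rewrite divr_gt0// lattice_weight_gt0.
- by move=> N eps; exact: (parity_class_complete hq ha e1 N).
Qed.

End Main.
Arguments gram_lattice {R q a} hq ha {e} _ n n'.
Arguments gram_lattice_dual {R q a} hq ha e i j.

Theorem mainTheorem6 (R : realType) (q a : R) (hq : 0 < q < 1) (ha : 0 < a) :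
  [/\ forall n n' : nat,
        series (fun k : nat => even_weight q a k *
                  (Dtilde q a n).[mu q (- a) (2 * k)%:R] *
                  (Dtilde q a n').[mu q (- a) (2 * k)%:R]) @ \oo
        --> Dtilde_norm2 q a n * (n == n')%:R,
      forall n n' : nat,
        series (fun k : nat => odd_weight q a k *
                  (Dtilde q a n).[mu q (- a) (2 * k + 1)%:R] *
                  (Dtilde q a n').[mu q (- a) (2 * k + 1)%:R]) @ \oo
        --> Dtilde_norm2 q a n * (n == n')%:R,
      extremal (discrete_measure (fun k => mu q (- a) (2 * k)%:R)
                  (even_weight_ge0 hq ha)) (Dtilde q a) &
      extremal (discrete_measure (fun k => mu q (- a) (2 * k + 1)%:R)
                  (odd_weight_ge0 hq ha)) (Dtilde q a)].
Proof.
have even_orth n n' : has_sum (fun k => even_weight q a k *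
    ((Dtilde q a n).[mu q (- a) (2 * k)%:R] *
     (Dtilde q a n').[mu q (- a) (2 * k)%:R]))
    (dual_mass q a / dual_weight q a n * (n == n')%:R).
  apply: has_sum_ext (gram_lattice hq ha (leq0n 1) n n') => k.
  by rewrite even_weightE addn0.
have odd_orth n n' : has_sum (fun k => odd_weight q a k *
    ((Dtilde q a n).[mu q (- a) (2 * k + 1)%:R] *
     (Dtilde q a n').[mu q (- a) (2 * k + 1)%:R]))
    (dual_mass q a / dual_weight q a n * (n == n')%:R).
  by apply: has_sum_ext (gram_lattice hq ha (leqnn 1) n n') => k; rewrite odd_weightE.
split.
- move=> n n'; rewrite Dtilde_norm2E//; apply: has_sum_ext (even_orth n n') => k.
  by rewrite mulrA.
- move=> n n'; rewrite Dtilde_norm2E//; apply: has_sum_ext (odd_orth n n') => k.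
  by rewrite mulrA.
- apply: (@extremal_discrete R (fun k => mu q (- a) (2 * k)%:R) (even_weight q a)
    _ (Dtilde q a) (fun n => dual_mass q a / dual_weight q a n)
    (even_weight_gt0 hq ha) (Dtilde_norm2_gt0 hq ha) even_orth) => k l.
  by have := gram_lattice_dual hq ha 0 k l; rewrite even_weightE !addn0.
- apply: (@extremal_discrete R (fun k => mu q (- a) (2 * k + 1)%:R) (odd_weight q a)
    _ (Dtilde q a) (fun n => dual_mass q a / dual_weight q a n)
    (odd_weight_gt0 hq ha) (Dtilde_norm2_gt0 hq ha) odd_orth) => k l.
  by have := gram_lattice_dual hq ha 1 k l; rewrite odd_weightE.
Qed.
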